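(* Let $\ell\ge2$ and $N\ge\ell+1$, and let $S$ be the set of pairs $(a,b)$ of integers such that either $1\le a<\ell-1$ and $1\le b<N-\ell$; or $a=\ell-1$ and $1\le b\le\lfloor(N-\ell)/2\rfloor$; or $1\le a\le\lfloor(\ell-1)/2\rfloor$ and $b=N-\ell$; or $(a,b)=(\ell-1,N-\ell)$. Then for $(a_1,b_1),(a_2,b_2)\in S$, we have $[a_1,b_1]\le_s[a_2,b_2]$ in $\mathcal{M}_{N,\ell}$ if and only if $a_1\le_h a_2$ and $b_1\le_w b_2$.
   Context: For a composition $\alpha=(\alpha_1,\dots,\alpha_\ell)$ of positive integers, the ribbon $\alpha$ is the unique connected skew diagram with no $2\times2$ block of boxes whose $i$-th row from the top has $\alpha_i$ boxes, and $r(\alpha)$ is its skew Schur function; $1^j$ denotes $j$ parts equal to $1$. A ribbon is multiplicity-free if all coefficients in the Schur expansion of $r(\alpha)$ are $0$ or $1$. $\mathcal{M}_{N,\ell}$ is the poset of multiplicity-free ribbons with $N$ boxes and $\ell$ rows (ribbons with equal ribbon Schur functions identified), ordered by $\alpha\le_s\beta$ iff $r(\beta)-r(\alpha)$ is a non-negative linear combination of Schur functions. For $1\le a\le\ell-1$, $1\le b\le N-\ell$ put $r[a,b]:=r(N-\ell-b+1,1^{a-1},b+1,1^{\ell-a-1})$ and let $[a,b]$ be the class of ribbons with ribbon Schur function $r[a,b]$. Fix $0<\varepsilon<1/2$. The total order $<_h$ on $\{1,\dots,\ell-1\}$ is: $a<_h a'$ iff $|a-(\ell/2-\varepsilon)|>|a'-(\ell/2-\varepsilon)|$,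 i.e. $\ell-1<_h1<_h\ell-2<_h2<_h\cdots<_h\lfloor\ell/2\rfloor$. The total order $<_w$ on $\{1,\dots,N-\ell\}$ is: $b<_w b'$ iff $|b-(\frac{N-\ell+1}{2}-\varepsilon)|>|b'-(\frac{N-\ell+1}{2}-\varepsilon)|$, i.e. $N-\ell<_w1<_wN-\ell-1<_w2<_w\cdots<_w\lfloor(N-\ell+1)/2\rfloor$. *)

(* Defs.v *)
From HB Require Import structures.
From mathcomp Require Import all_boot all_order all_algebra.
From mathcomp Require Import mpoly.

Set Implicit Arguments.
Unset Strict Implicit.
Unset Printing Implicit Defensive.

Import Order.TTheory GRing.Theory Num.Theory.

(* Boxes are pairs (row, column), both counted from 0, rows from the top
   (English convention).  Box (i, j) lies in la/mu iff mu_i <= j < la_i; parts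
   beyond the end of a sequence are 0. *)
Definition is_partition (la : seq nat) : bool :=
  sorted geq la && (0 \notin la).

Definition in_skew (la mu : seq nat) (i j : nat) : bool :=
  nth 0 mu i <= j < nth 0 la i.

(* Since la is a partition, its columns are numbered below head 0 la. *)
Definition skew_box (la mu : seq nat) :=
  {c : 'I_(size la) * 'I_(head 0 la) | in_skew la mu c.1 c.2}.

Section Tableaux.
Variables la mu : seq nat.

Definition brow (c : skew_box la mu) : nat := (val c).1.
Definition bcol (c : skew_box la mu) : nat := (val c).2.

Definition semistandard (n : nat) (T : {ffun skew_box la mu -> 'I_n}) : bool :=
  [forall c, forall d,
     ((brow c == brow d) && (bcol c <= bcol d) ==> (T c <= T d)) &&
     ((bcol c == bcol d) && (brow c < brow d) ==> (T c < T d))].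

Definition box_adj (c d : skew_box la mu) : bool :=
  [|| (brow c == brow d) && (bcol d == (bcol c).+1),
      (brow c == brow d) && (bcol c == (bcol d).+1),
      (bcol c == bcol d) && (brow d == (brow c).+1) |
      (bcol c == bcol d) && (brow c == (brow d).+1)].

Definition skew_connected : Prop := forall c d, connect box_adj c d.

Definition no_2x2_block : Prop :=
  forall i j, ~~ [&& in_skew la mu i j, in_skew la mu i j.+1,
                     in_skew la mu i.+1 j & in_skew la mu i.+1 j.+1].

End Tableaux.

(* A symmetric function (an element of the inverse limit of the rings of
   symmetric polynomials) is given by its specializations to x_0, ..., x_{n-1}
   for every n; two of them are equal iff all specializations are. *)
Definition symfun := forall n : nat, {mpoly int[n]}.

Definition symfun_eq (F G : symfun) : Prop := forall n, F n = G n.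

Definition symfun_sub (F G : symfun) : symfun := fun n => (F n - G n)%R.

Definition skew_schur (la mu : seq nat) : symfun := fun n =>
  (\sum_(T : {ffun skew_box la mu -> 'I_n} | semistandard T)
     \prod_(c : skew_box la mu) 'X_(T c))%R.

Definition schur (la : seq nat) : symfun := skew_schur la [::].

(* F is the finite linear combination of the s_la, la in s, with
   coefficients c la. *)
Definition schur_expansion (F : symfun) (s : seq (seq nat))
    (c : seq nat -> int) : Prop :=
  [/\ uniq s, all is_partition s &
      forall n, F n = (\sum_(la <- s) c la *: schur la n)%R].

Definition schur_nonneg (F : symfun) : Prop :=
  exists s c, schur_expansion F s c /\ forall la, la \in s -> (0 <= c la)%R.

Definition schur_mult_free (F : symfun) : Prop :=
  exists s c, schur_expansion F s c /\
    forall la, la \in s -> c la = 0%R \/ c la = 1%R.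

Definition is_composition (al : seq nat) : bool := 0 \notin al.

(* The ribbon al is outer/inner: row i (with al_i boxes) starts in column
   \sum_(k > i) (al_k - 1), so that consecutive rows share exactly one column.
   See ribbon_shapeP for the defining properties. *)
Definition ribbon_outer (al : seq nat) : seq nat :=
  mkseq (fun i => (sumn (map predn (drop i al))).+1) (size al).

Definition ribbon_inner (al : seq nat) : seq nat :=
  mkseq (fun i => sumn (map predn (drop i.+1 al))) (size al).

Definition ribbon_schur (al : seq nat) : symfun :=
  skew_schur (ribbon_outer al) (ribbon_inner al).

Definition mf_ribbon (N l : nat) (al : seq nat) : Prop :=
  [/\ is_composition al, sumn al = N, size al = l &
      schur_mult_free (ribbon_schur al)].

(* The elements of the poset M_{N,l} are classes of ribbons, i.e. predicates
   on compositions. *)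
Definition ribbon_class (N l : nat) (F : symfun) : seq nat -> Prop :=
  fun al => mf_ribbon N l al /\ symfun_eq (ribbon_schur al) F.

Definition in_M (N l : nat) (A : seq nat -> Prop) : Prop :=
  exists2 al, mf_ribbon N l al &
    forall be, A be <-> ribbon_class N l (ribbon_schur al) be.

(* The order of the poset M_{N,l}; in particular both sides are elements
   of it. *)
Definition le_s (N l : nat) (A B : seq nat -> Prop) : Prop :=
  [/\ in_M N l A, in_M N l B &
      forall al be, A al -> B be ->
        schur_nonneg (symfun_sub (ribbon_schur be) (ribbon_schur al))].

Definition r_ab (N l a b : nat) : symfun :=
  ribbon_schur ((N - l - b + 1) :: nseq (a - 1) 1
                ++ (b + 1) :: nseq (l - a - 1) 1).

Definition class_ab (N l a b : nat) : seq nat -> Prop :=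
  ribbon_class N l (r_ab N l a b).

Section Orders.
Local Open Scope ring_scope.
Variables (R : realFieldType) (eps : R).

Definition lt_h (l a a' : nat) : Prop :=
  `|a%:R - (l%:R / 2 - eps)| > `|a'%:R - (l%:R / 2 - eps)|.

Definition lt_w (N l b b' : nat) : Prop :=
  `|b%:R - ((N - l + 1)%N%:R / 2 - eps)| >
  `|b'%:R - ((N - l + 1)%N%:R / 2 - eps)|.

Definition le_h (l a a' : nat) : Prop := a = a' \/ lt_h l a a'.
Definition le_w (N l b b' : nat) : Prop := b = b' \/ lt_w N l b b'.

End Orders.

Definition in_S (N l a b : nat) : Prop :=
  [\/ 1 <= a < l - 1 /\ 1 <= b < N - l,
      a = l - 1 /\ 1 <= b <= (N - l) %/ 2,
      1 <= a <= (l - 1) %/ 2 /\ b = N - l |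
      a = l - 1 /\ b = N - l].

Lemma box_exists la mu i j : is_partition la -> in_skew la mu i j ->
  exists c : skew_box la mu, brow c = i /\ bcol c = j.
Proof.
case/andP=> srt _ hij; have /andP[_ ltj] := hij.
have lti : i < size la.
  by case: (ltnP i (size la)) ltj => // le; rewrite nth_default.
have ltj' : j < head 0 la.
  apply: leq_trans ltj _; rewrite -nth0.
  have geqT : transitive geq by move=> y x z xy yz; exact: leq_trans yz xy.
  have := sorted_leq_nth geqT leqnn 0 srt.
  by apply; rewrite ?inE //; apply: leq_ltn_trans lti.
by exists (exist _ (Ordinal lti, Ordinal ltj') hij).
Qed.

Lemma nth_outer al i : is_composition al -> i < size al ->
  nth 0 (ribbon_outer al) i = nth 0 (ribbon_inner al) i + nth 0 al i.
Proof.
move=> al0 lti; rewrite !nth_mkseq // (drop_nth 0 lti) /= addnC -addnS prednK //.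
by rewrite lt0n; apply: contraNneq al0 => <-; apply: mem_nth.
Qed.

Lemma nth_outerS al i : i.+1 < size al ->
  nth 0 (ribbon_outer al) i.+1 = (nth 0 (ribbon_inner al) i).+1.
Proof. by move=> lti; rewrite !nth_mkseq // ltnW. Qed.

Lemma nth_innerS al i : i.+1 < size al ->
  nth 0 (ribbon_inner al) i.+1 <= nth 0 (ribbon_inner al) i.
Proof.
move=> lti; rewrite !nth_mkseq ?(ltnW lti) // (drop_nth 0 lti) /=.
exact: leq_addl.
Qed.

Lemma inner_lt_outer al i : i < size al ->
  nth 0 (ribbon_inner al) i < nth 0 (ribbon_outer al) i.
Proof.
by move=> lti; rewrite !nth_mkseq // ltnS (drop_nth 0 lti) /= leq_addl.
Qed.

Lemma in_ribbon_size al mu i j :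
  in_skew (ribbon_outer al) mu i j -> i < size al.
Proof.
case: (ltnP i (size al)) => // le /andP[_].
by rewrite nth_default ?size_mkseq.
Qed.

Lemma ribbon_outer_part al : is_partition (ribbon_outer al).
Proof.
apply/andP; split; last by apply/negP => /mapP[].
apply/(sortedP 0) => i; rewrite size_mkseq => lti.
by rewrite /= nth_outerS // inner_lt_outer // ltnW.
Qed.

Lemma box_adj_sym la mu : ssrbool.symmetric (@box_adj la mu).
Proof.
move=> c d; rewrite /box_adj (eq_sym (brow d) (brow c)).
rewrite (eq_sym (bcol d) (bcol c)).
by do 6!case: (_ == _).
Qed.

Lemma ribbon_connected al :
  skew_connected (ribbon_outer al) (ribbon_inner al).
Proof.
set la := ribbon_outer al; set mu := ribbon_inner al.
have sym : connect_sym (@box_adj la mu).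
  exact: sym_connect_sym (@box_adj_sym la mu).
have la_part : is_partition la := ribbon_outer_part al.
have corner c : exists d : skew_box la mu,
    [/\ connect (@box_adj la mu) c d, (brow d).+1 = size al & bcol d = 0].
  have [m] := ubnP (size al - brow c + bcol c).
  elim: m c => // m IHm c; rewrite ltnS => lem.
  have hc : in_skew la mu (brow c) (bcol c) := valP c.
  have lts := in_ribbon_size hc; have /andP[le_mu lt_la] := hc.
  have step (c' : skew_box la mu) : box_adj c c' ->
      size al - brow c' + bcol c' < size al - brow c + bcol c ->
      exists d : skew_box la mu,
      [/\ connect (@box_adj la mu) c d, (brow d).+1 = size al & bcol d = 0].
    move=> adj lt; have [|d [cd rd cold]] := IHm c'; first exact: leq_trans lem.
    by exists d; split=> //; apply: connect_trans cd; apply: connect1.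
  have [lt_mu|le_mu'] := ltnP (nth 0 mu (brow c)) (bcol c).
    have [|c' [rc' cc']] := @box_exists la mu (brow c) (bcol c).-1 la_part.
      apply/andP; split; first by rewrite -ltnS (ltn_predK lt_mu).
      by apply: leq_ltn_trans lt_la; apply: leq_pred.
    apply: (step c'); first by rewrite /box_adj rc' cc' (ltn_predK lt_mu) !eqxx !orbT.
    by rewrite rc' cc' ltn_add2l -{2}(ltn_predK lt_mu).
  have eq_mu : bcol c = nth 0 mu (brow c).
    by apply/eqP; rewrite eqn_leq le_mu' le_mu.
  have [lts'|ge] := ltnP (brow c).+1 (size al).
    have [|c' [rc' cc']] := @box_exists la mu (brow c).+1 (bcol c) la_part.
      by rewrite /in_skew eq_mu nth_innerS //= nth_outerS.
    apply: (step c'); first by rewrite /box_adj rc' cc' !eqxx !orbT.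
    by rewrite rc' cc' ltn_add2r ltn_sub2l.
  have eqs : (brow c).+1 = size al by apply/eqP; rewrite eqn_leq lts ge.
  exists c; split; [exact: connect0 | by [] | rewrite eq_mu nth_mkseq //].
  by rewrite eqs drop_size.
move=> c d; have [c' [cc' rc' kc']] := corner c.
have [d' [dd' rd' kd']] := corner d.
suff eq_cd : c' = d'.
  by apply: connect_trans cc' _; rewrite eq_cd sym.
apply/val_inj/eqP; rewrite -pair_eqE; apply/andP; split; apply/eqP/val_inj.
  by apply: succn_inj; rewrite [LHS]rc' [RHS]rd'.
by rewrite [LHS]kc' [RHS]kd'.
Qed.

Lemma ribbon_no_2x2 al : no_2x2_block (ribbon_outer al) (ribbon_inner al).
Proof.
move=> i j; apply/negP => /and4P[/andP[le _] _ _ h].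
have lts := in_ribbon_size h; move: h => /andP[_].
by rewrite nth_outerS // ltnS ltnNge le.
Qed.

Lemma ribbon_shapeP al : is_composition al ->
  let la := ribbon_outer al in let mu := ribbon_inner al in
  [/\ is_partition la,
      sorted geq mu /\ (forall i, nth 0 mu i <= nth 0 la i),
      size la = size al /\
        (forall i, i < size al -> nth 0 la i - nth 0 mu i = nth 0 al i),
      skew_connected la mu & no_2x2_block la mu].
Proof.
move=> al0 la mu; split; [exact: ribbon_outer_part | | |
  exact: ribbon_connected | exact: ribbon_no_2x2].
  split; first by apply/(sortedP 0) => i; rewrite size_mkseq; apply: nth_innerS.
  move=> i; have [lti|ge] := ltnP i (size al).
    exact/ltnW/inner_lt_outer.
  by rewrite !nth_default ?size_mkseq.
split; first by rewrite size_mkseq.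
by move=> i lti; rewrite /la nth_outer // addKn.
Qed.

(* Main.v *)
(* Multiplying Schur functions by the alternant a_rho turns them into alternants
   a_(la + rho) (row operations on the determinant reproduce the branching rule
   of tableaux), and for alternants the Pieri rule for e_c is one line.  Reading
   a ribbon from its top right end, "left" steps can be eliminated by
   inclusion-exclusion in favour of products by e_c, so the ribbon Schur function
   is the sum of s_la over the ends la of all chains of partitions that add one
   box at a time in rows following the pattern of the ribbon.  For the ribbons
   of r[a,b], with n = N - l, the chains can be listed:

     r[a,b] = s_(n+1, 1^(l-1))
       + \sum s_(n+1-j, 1+j, 2^r, 1^(l-2-2r))
           over 1 <= j <= min(b, n-b) and 0 <= r <= min(a-1, l-a-1)
       + \sum s_(n+1-j, 2+j, 2^r, 1^(l-3-2r))
           over 0 <= j <= min(b-1, n-b) and 0 <= r <= min(a-1, l-a-2).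

   Since all coefficients are 1, the order is inclusion of supports, and the
   four bounds increase along <_h and <_w. *)
Require Import Defs.
From mathcomp Require Import all_boot all_order all_algebra.
From mathcomp Require Import perm mpoly zify ring lra.

Set Implicit Arguments.
Unset Strict Implicit.
Unset Printing Implicit Defensive.

Import Order.TTheory GRing.Theory Num.Theory.
Local Open Scope ring_scope.

(** * Alternants *)

(** Every identity is needed for each number of variables, including numbers smaller than the number
    of rows of a shape. There the alternant a_(la + rho) no longer sees the rows of la beyond the
    last variable. The end value of a chain is therefore replaced by the product of a_rho and s_la,
    which agrees with a_(la + rho) as long as the rows fit and is 0 afterwards; the chains can then
    be listed with as many rows as they want.

    The set S is shaped by families that may be empty. For a = l - 1 the second family is empty, and
    the first one depends on b only through min(b, n - b), so b and n - b give the same function.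
    For b = n the first family is empty, and a and l - 1 - a give the same function. S keeps those
    representatives for which the bounds that cannot be read off the support follow from the ones
    that can. *)

Lemma det_sum (R : comNzRingType) n (J : finType) (P : 'I_n -> pred J)
    (G : 'I_n -> J -> 'I_n -> R) :
  \det (\matrix_(i, j) \sum_(k | P i k) G i k j) =
  \sum_(f : {ffun 'I_n -> J} | [forall i, P i (f i)])
    \det (\matrix_(i, j) G i (f i) j).
Proof.
rewrite [LHS]/determinant; under eq_bigr => s _.
  under eq_bigr => i _ do rewrite mxE.
  rewrite bigA_distr_big_dep big_distrr /=; over.
rewrite exchange_big /=; apply: eq_big => [f|f _].
  by apply/familyP/forallP.
by apply: eq_bigr => s _; congr (_ * _); apply: eq_bigr => i _; rewrite mxE.
Qed.

(** A shifted geometric sum. It is applied with [a] and [b] two consecutive parts of a shape, so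
    that [m] runs through the lengths that interlacing allows for one row. *)
Lemma subrXX_interval (R : comNzRingType) (x y : R) a b c : (a <= b)%N ->
  x ^+ (b + c).+1 - y ^+ (b - a).+1 * x ^+ (a + c) =
  (x - y) * \sum_(a <= m < b.+1) x ^+ (m + c) * y ^+ (b - m).
Proof.
move=> ab; rewrite big_distrr /= -(subnK ab) addnK.
elim: (b - a)%N => {ab b}[|d IH]; first by rewrite !add0n big_nat1 subnn !exprS expr0; ring.
rewrite addSn big_nat_recr /=; last by lia.
rewrite subnn expr0 mulr1.
have -> : \sum_(a <= i < (d + a).+1) (x - y) * (x ^+ (i + c) * y ^+ ((d + a).+1 - i))
  = y * \sum_(a <= i < (d + a).+1) (x - y) * (x ^+ (i + c) * y ^+ (d + a - i)).
  rewrite big_distrr /=; apply: eq_big_nat => i /andP[_ hi].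
  by rewrite subSn // exprS; ring.
by rewrite -IH !addSn !exprS; ring.
Qed.

Section Alternants.
Variables (R : comNzRingType) (x : nat -> R).

(* The rows are indexed by the exponents, so that Leibniz' formula reads
   \sum_s (-1) ^+ s * \prod_j x (s j) ^+ (lam j + n - 1 - j). *)
Definition alt n (lam : nat -> nat) : R :=
  \det (\matrix_(j < n, i < n) x i ^+ (lam j + (n - j.+1))).

Lemma eq_alt n lam mu : (forall j, (j < n)%N -> lam j = mu j) ->
  alt n lam = alt n mu.
Proof.
by move=> e; congr (\det _); apply/matrixP => j i; rewrite !mxE e.
Qed.

Lemma alt_eq0 n lam j : (j.+1 < n)%N -> lam j.+1 = (lam j).+1 -> alt n lam = 0.
Proof.
move=> ltj e; have ltj' := ltnW ltj.
apply: (@determinant_alternate _ _ _ (Ordinal ltj') (Ordinal ltj)).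
  by rewrite -val_eqE /= neq_ltn ltnSn.
move=> i; rewrite !mxE /= e; congr (_ ^+ _); lia.
Qed.

Definition ext n (g : 'I_n -> nat) (j : nat) : nat :=
  if insub j is Some j' then g j' else 0.

Lemma extE n g (j : 'I_n) : ext g j = g j.
Proof. by rewrite /ext valK. Qed.

Lemma ext_ge n (g : 'I_n -> nat) j : (n <= j)%N -> ext g j = 0%N.
Proof. by move=> h; rewrite /ext insubN // -leqNgt. Qed.

Definition interlace n (lam : nat -> nat) (g : 'I_n -> nat) : bool :=
  [forall j : 'I_n, lam j.+1 <= g j <= lam j]%N.

(** Subtracting from each row a multiple of the next clears the last column except for its bottom
    entry. In the remaining minor, column i is divisible by [x i - x n], and each quotient row is a
    sum over the possible values of [g j]; multilinearity does the rest. [K] bounds these values so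
    that the [g] form a finite type. *)
Lemma alt_branch n K lam :
    (forall j, (lam j.+1 <= lam j)%N) -> (lam 0 < K)%N ->
  alt n.+1 lam = \prod_(i < n) (x i - x n) *
    \sum_(g : {ffun 'I_n -> 'I_K} | interlace lam (fun j => nat_of_ord (g j)))
      x n ^+ (lam n + \sum_(j < n) (lam j - g j)) * alt n (ext (fun j => nat_of_ord (g j))).
Proof.
move=> dec ltK; rewrite /alt.
have lamK j : (lam j < K)%N.
  by elim: j => // j IH; apply: leq_ltn_trans IH.
set M := \matrix_(j < n.+1, i < n.+1) _.
pose U := \matrix_(j < n.+1, i < n.+1)
  (if j == i then 1 else if i == j.+1 :> nat then - x n ^+ (lam j - lam j.+1).+1
   else 0 : R).
have detU : \det U = 1.
  rewrite -det_tr det_trig; first by rewrite big1 // => i _; rewrite !mxE eqxx.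
  apply/is_trig_mxP => i j ltij; rewrite !mxE -val_eqE /= gtn_eqF //.
  by rewrite ltn_eqF // ltnS ltnW.
have UM (j i : 'I_n.+1) : (U *m M) j i =
    x i ^+ (lam j + (n.+1 - j.+1)) -
    (if (j < n)%N then
       x n ^+ (lam j - lam j.+1).+1 * x i ^+ (lam j.+1 + (n.+1 - j.+2)) else 0).
  rewrite !mxE (bigD1 j) //= !mxE eqxx mul1r; congr (_ + _).
  case: ifP => ltj.
    rewrite (bigD1 (Ordinal (ltj : (j.+1 < n.+1)%N))) /=; last first.
      by rewrite -val_eqE /= gtn_eqF.
    rewrite !mxE -val_eqE /= ltn_eqF // eqxx mulNr big1 ?addr0 // => k /andP[k1 k2].
    rewrite !mxE eq_sym (negPf k1).
    by move: k2; rewrite -val_eqE /= => /negPf ->; rewrite mul0r.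
  rewrite big1 ?oppr0 // => k k1; rewrite !mxE eq_sym (negPf k1).
  case: eqP => [e|_]; last by rewrite mul0r.
  by have := ltn_ord k; rewrite e ltnS ltj.
have -> : \det M = \det (U *m M) by rewrite det_mulmx detU mul1r.
rewrite (expand_det_col _ ord_max).
rewrite (bigD1 ord_max) //= big1 ?addr0; last first.
  move=> j nj; rewrite UM /=; have ltj : (j < n)%N.
    by move: nj (ltn_ord j); rewrite -val_eqE /= ltnS leq_eqVlt => /negPf ->.
  rewrite ltj -exprD.
  have -> : (lam j + (n.+1 - j.+1) =
    (lam j - lam j.+1).+1 + (lam j.+1 + (n.+1 - j.+2)))%N.
    by have := dec j; lia.
  by rewrite subrr mul0r.
rewrite UM /= ltnn subr0 subnn addn0 /cofactor addnn -signr_odd odd_double expr0 mul1r.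
set D := row' _ _.
have -> : D = (\matrix_(j < n, i < n)
    \sum_(m < K | (lam j.+1 <= m <= lam j)%N)
       (x n ^+ (lam j - m) * x i ^+ (m + (n - j.+1)))) *m
    diag_mx (\row_(i < n) (x i - x n)).
  apply/matrixP => j i; rewrite mxE mxE UM mul_mx_diag !mxE.
  rewrite !lift_max ltn_ord.
  have h1 : (lam j + (n.+1 - j.+1) = (lam j + (n - j.+1)).+1)%N.
    by have := ltn_ord j; lia.
  have h2 : (n.+1 - j.+2 = n - j.+1)%N by lia.
  rewrite h1 h2 subrXX_interval // mulrC; congr (_ * _).
  rewrite big_geq_mkord
    (big_ord_widen_cond K _ (fun m => x i ^+ (m + (n - j.+1)) * x n ^+ (lam j - m))) //.
  by apply: eq_big => m; [rewrite ltnS | rewrite mulrC].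
rewrite det_mulmx det_diag det_sum [X in _ * X]mulrC mulrCA; congr (_ * _).
  by apply: eq_bigr => i _; rewrite mxE.
rewrite big_distrr /=; apply: eq_bigr => g _.
rewrite exprD -mulrA; congr (_ * _); rewrite /alt.
rewrite -[in RHS]prodrXr.
pose dg := \row_(j < n) x n ^+ (lam j - g j).
have -> : \prod_(j < n) x n ^+ (lam j - g j) = \det (diag_mx dg).
  by rewrite det_diag; apply: eq_bigr => j _; rewrite mxE.
rewrite -det_mulmx; congr (\det _); apply/matrixP => j i.
by rewrite mul_diag_mx !mxE extE.
Qed.

End Alternants.

(** * Tableaux and the bialternant formula *)

Lemma count_initial (p : pred nat) b k :
    (forall i j, (i <= j)%N -> p j -> p i) -> (k < b)%N ->
  p k = (k < count p (iota 0 b))%N.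
Proof.
move=> dwn; elim: b => // b IH; rewrite ltnS leq_eqVlt
  -[X in iota 0 X]addn1 iotaD count_cat /= add0n addn0.
have le_b : (count p (iota 0 b) <= b)%N.
  by rewrite -{2}(size_iota 0 b); apply: count_size.
case/predU1P => [->|ltk].
  case: (boolP (p b)) => pb; last by rewrite addn0 ltnNge le_b.
  have -> : count p (iota 0 b) = b.
    rewrite -{2}(size_iota 0 b); apply/eqP; rewrite -all_count; apply/allP => i.
    by rewrite mem_iota => /andP[_ /ltnW h]; apply: dwn pb.
  by rewrite addn1 ltnSn.
rewrite IH //; case: (boolP (p b)) => pb; last by rewrite addn0.
rewrite -IH // addn1 ltnS; apply/idP/idP => [pk|_]; last by apply: dwn pb; apply: ltnW.
by apply: ltnW; rewrite -IH.
Qed.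

Lemma sum_ord_supp (F : nat -> nat) a m :
    (forall j, (a <= j)%N -> F j = 0%N) -> (forall j, (m <= j)%N -> F j = 0%N) ->
  (\sum_(j < a) F j = \sum_(j < m) F j)%N.
Proof.
have gen u v : (u <= v)%N -> (forall j, (u <= j)%N -> F j = 0%N) ->
    (\sum_(j < u) F j = \sum_(j < v) F j)%N.
  move=> le h; rewrite (big_ord_widen v F le) [RHS](bigID (fun j : 'I_v => (j < u)%N)) /=.
  by rewrite [X in _ = (_ + X)%N]big1 ?addn0 // => j; rewrite -leqNgt => /h.
by move=> ha hm; case: (leqP a m) => [|/ltnW] le; [|symmetry]; apply: gen.
Qed.

Section Tableaux.
Variables (R : comNzRingType) (x : nat -> R) (a b q : nat).
Local Notation arr := {ffun 'I_a * 'I_b -> 'I_q.+1}.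

(* A tableau of shape lam with entries less than n is stored as an array on
   the full a x b rectangle, with the value n outside lam. *)
Definition ssyt n (lam : nat -> nat) (f : arr) : bool :=
  [forall c : 'I_a * 'I_b, if (c.2 < lam c.1)%N then (f c < n)%N else f c == n :> nat] &&
  [forall c : 'I_a * 'I_b, forall d : 'I_a * 'I_b,
     ((c.1 == d.1) && (c.2 <= d.2)%N ==> (f c <= f d)%N) &&
     ([&& c.2 == d.2, (c.1 < d.1)%N & (d.2 < lam d.1)%N] ==> (f c < f d)%N)].

Definition tab n lam : R :=
  \sum_(f : arr | ssyt n lam f) \prod_(c : 'I_a * 'I_b | (c.2 < lam c.1)%N) x (f c).

Lemma ssytP n (lam : nat -> nat) (f : arr) : reflect
  [/\ forall c : 'I_a * 'I_b, (c.2 < lam c.1)%N -> (f c < n)%N,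
      forall c : 'I_a * 'I_b, (lam c.1 <= c.2)%N -> f c = n :> nat,
      forall (i : 'I_a) (k k' : 'I_b), (k <= k')%N -> (f (i, k) <= f (i, k'))%N &
      forall (i i' : 'I_a) (k : 'I_b), (i < i')%N -> (k < lam i')%N -> (f (i, k) < f (i', k))%N]
  (ssyt n lam f).
Proof.
apply: (iffP andP) => [[/forallP h1 /forallP h2]|[h1 h2 h3 h4]].
  split=> [c lt|c le|i k k' le|i i' k lt1 lt2].
  - by have := h1 c; rewrite lt.
  - by have := h1 c; rewrite ltnNge le /= => /eqP.
  - by have /forallP/(_ (i, k')) := h2 (i, k); rewrite /= eqxx le => /andP[].
  - by have /forallP/(_ (i', k)) := h2 (i, k); rewrite /= eqxx lt1 lt2 => /andP[].
split; first by apply/forallP => c; case: ltnP => h; [apply: h1 | rewrite h2].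
apply/forallP => -[i k]; apply/forallP => -[i' k'] /=; apply/andP; split.
  by apply/implyP => /andP[/eqP -> le]; apply: h3.
by apply/implyP => /and3P[/eqP -> lt1 lt2]; apply: h4.
Qed.

Lemma decr_le (lam : nat -> nat) : (forall j, lam j.+1 <= lam j)%N ->
  forall i j, (i <= j)%N -> (lam j <= lam i)%N.
Proof.
move=> dec i j /subnK <-; elim: (j - i)%N => // d IH.
by rewrite addSn; apply: leq_trans IH.
Qed.

Lemma ssyt_ge_row n lam (f : arr) (i : 'I_a) (k : 'I_b) :
    (forall j, lam j.+1 <= lam j)%N -> ssyt n lam f -> (k < lam i)%N ->
  (i <= f (i, k))%N.
Proof.
move=> dec /ssytP[_ _ _ h4]; case: i => i /=; elim: i => // i IH lti ltk.
apply: leq_ltn_trans (IH (ltnW lti) _) (h4 _ _ _ _ _) => //.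
exact: leq_trans ltk (dec i).
Qed.

(** The row length of the subtableau of entries below [n]. Counting over natural numbers gives 0 for
    rows outside the array. *)
Definition subshape_row n (f : arr) j : nat :=
  count (fun k => [exists c : 'I_a * 'I_b,
     [&& c.1 == j :> nat, c.2 == k :> nat & (f c < n)%N]]) (iota 0 b).

Lemma lt_subshape_row n m lam (f : arr) (i : 'I_a) (k : 'I_b) : ssyt m lam f ->
  (k < subshape_row n f i)%N = (f (i, k) < n)%N.
Proof.
move=> /ssytP[_ _ h3 _]; rewrite -count_initial //; last first.
  move=> k1 k2 le12 /existsP[[i' k'] /= /and3P[/eqP e1 /eqP e2 lt]].
  have lt1 : (k1 < b)%N by rewrite (leq_ltn_trans le12) // -e2.
  apply/existsP; exists (i', Ordinal lt1); rewrite /= e1 !eqxx /=.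
  by apply: leq_ltn_trans lt; apply: h3; rewrite /= e2.
apply/existsP/idP => [[[i' k'] /= /and3P[/eqP e1 /eqP e2]]|lt].
  by rewrite (val_inj e1) (val_inj e2).
by exists (i, k); rewrite !eqxx.
Qed.

Lemma subshape_row_le n f j : (subshape_row n f j <= b)%N.
Proof. by rewrite -[X in (_ <= X)%N](size_iota 0 b) count_size. Qed.

Lemma subshape_row_ge n f j : (a <= j)%N -> subshape_row n f j = 0%N.
Proof.
move=> le; rewrite /subshape_row (eq_count (a2 := pred0)) ?count_pred0 // => k.
apply/existsP => -[[i k'] /= /and3P[/eqP e _ _]].
by have := ltn_ord i; rewrite e ltnNge le.
Qed.

Lemma leq_of_ltn u v : (u <= b)%N -> (forall k : 'I_b, (k < u)%N -> (k < v)%N) ->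
  (u <= v)%N.
Proof.
case: u => // u le h; exact: (h (Ordinal le)).
Qed.

(** Removing the largest entry [n] leaves a shape interlacing [lam], because columns are strict. The
    exponent of [x n] counts the removed boxes; row [n] is counted apart, since it is removed
    completely. *)
Lemma tab_branch n lam : (n < q)%N ->
    (forall j, lam j.+1 <= lam j)%N -> (lam 0 <= b)%N -> lam a = 0%N ->
    lam n.+1 = 0%N ->
  tab n.+1 lam = \sum_(g : {ffun 'I_n -> 'I_b.+1} |
                         interlace lam (fun j => nat_of_ord (g j)))
    x n ^+ (lam n + \sum_(j < n) (lam j - g j)) * tab n (ext (fun j => nat_of_ord (g j))).
Proof.
move=> ltnq dec leb lama lamn.
have lamle := decr_le dec.
have lamb j : (lam j <= b)%N by apply: leq_trans leb; apply: lamle.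
pose shp (f : arr) : {ffun 'I_n -> 'I_b.+1} := [ffun j : 'I_n => inord (subshape_row n f j)].
have shpE f j : shp f j = subshape_row n f j :> nat.
  by rewrite ffunE inordK // ltnS subshape_row_le.
(* The outside of the shape is marked by [n.+1] before the removal and by [n] after it. [dn] merges
   the entries [n] with the outside; [up] separates them again by means of [lam]. *)
pose up (f : arr) : arr := [ffun c : 'I_a * 'I_b => if (c.2 < lam c.1)%N then f c else inord n.+1].
pose dn (f : arr) : arr := [ffun c => inord (minn (f c) n)].
have dnE f c : dn f c = minn (f c) n :> nat.
  rewrite ffunE inordK //; lia.
have upE f c : up f c = (if (c.2 < lam c.1)%N then f c : nat else n.+1) :> nat.
  by rewrite ffunE; case: ifP => // _; rewrite inordK.
rewrite /tab
  (partition_big shp (fun g => interlace lam (fun j => nat_of_ord (g j)))) /=; last first.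
  move=> f fP; apply/forallP => j; rewrite shpE.
  have [h1 h2 h3 h4] := ssytP _ _ _ fP.
  case: (ltnP j a) => [ltj|gej]; last first.
    rewrite subshape_row_ge // leq0n andbT -lama; apply: lamle; lia.
  have ej : j = Ordinal ltj :> nat by [].
  apply/andP; split; apply: leq_of_ltn; rewrite ?subshape_row_le // => k ltk.
    rewrite ej (lt_subshape_row _ _ _ fP).
    have ltj1 : (j.+1 < a)%N.
      by rewrite ltnNge; apply/negP => /lamle; rewrite lama leqNgt (leq_ltn_trans _ ltk).
    have := h4 (Ordinal ltj) (Ordinal ltj1) k (ltnSn _) ltk.
    by have := h1 (Ordinal ltj1, k) ltk; lia.
  move: ltk; rewrite {1}ej (lt_subshape_row _ _ _ fP); case: (ltnP k (lam j)) => // le.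
  by rewrite (h2 (Ordinal ltj, k) le); lia.
apply: eq_bigr => g /forallP gP.
set G := ext _.
have GE (j : 'I_n) : G j = g j by rewrite /G extE.
have G0 j : (n <= j)%N -> G j = 0%N by move=> h; rewrite /G ext_ge.
have Gle j : (G j <= lam j)%N.
  case: (ltnP j n) => [h|h]; last by rewrite G0.
  by rewrite (GE (Ordinal h)); have /andP[] := gP (Ordinal h).
have Gge j : (lam j.+1 <= G j)%N.
  case: (ltnP j n) => [h|h].
    by rewrite (GE (Ordinal h)); have /andP[] := gP (Ordinal h).
  by rewrite G0 // -lamn lamle.
rewrite (reindex_onto up dn) /=; last first.
  move=> f /andP[/ssytP[h1 h2 _ _] _]; apply/ffunP => c; apply: val_inj => /=.
  rewrite upE; case: ltnP => h; last by rewrite h2.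
  by rewrite dnE; have := h1 c h; lia.
rewrite big_distrr /=; apply: eq_big => [h|h].
  apply/idP/idP => [/andP[/andP[uP /eqP sg] /eqP dh]|hP].
    have [h1 h2 h3 h4] := ssytP _ _ _ uP.
    have hE c : h c = minn (up h c) n :> nat by rewrite -{1}dh dnE.
    have key (c : 'I_a * 'I_b) : (c.2 < G c.1)%N = (up h c < n)%N.
      case: c => i k /=; case: (ltnP i n) => [lti|gei].
        by rewrite (GE (Ordinal lti)) -sg shpE /= (lt_subshape_row _ _ _ uP).
      rewrite G0 // ltn0; symmetry; apply/negbTE; rewrite -leqNgt.
      case: (ltnP k (lam i)) => ltk; last by rewrite (h2 (i, k)).
      exact: leq_trans gei (ssyt_ge_row dec uP ltk).
    apply/ssytP; split=> [c|c|i k k' le|i i' k lt ltG].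
    - by rewrite key hE; lia.
    - by rewrite leqNgt key hE; lia.
    - by rewrite !hE; have := h3 i k k' le; lia.
    - rewrite !hE; have := h4 i i' k lt (leq_trans ltG (Gle _)).
      by move: (key (i', k)) => /=; rewrite ltG; lia.
  have [h1 h2 h3 h4] := ssytP _ _ _ hP.
  have hle c : (h c <= n)%N.
    by case: (ltnP c.2 (G c.1)) => [/h1 /ltnW|/h2 ->].
  have uP : ssyt n.+1 lam (up h).
    apply/ssytP; split=> [c lt|c le|i k k' le|i i' k lt ltl].
    - by rewrite upE lt ltnS.
    - by rewrite upE ltnNge le.
    - rewrite !upE /=; case: (ltnP k' (lam i)) => lt'.
        by rewrite (leq_ltn_trans le lt') h3.
      by case: ifP => // _; rewrite leqW.
    - rewrite !upE /= ltl.
      have -> : (k < lam i)%N by apply: leq_trans ltl _; apply: lamle; apply: ltnW.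
      case: (ltnP k (G i')) => ltG; first exact: h4.
      rewrite (h2 (i', k) ltG); apply: h1 => /=; apply: leq_trans (Gge i).
      exact: leq_trans ltl (lamle _ _ lt).
  rewrite uP /=; apply/andP; split; apply/eqP/ffunP.
    move=> j; apply: val_inj => /=; rewrite shpE.
    case: (ltnP j a) => [ltj|gej]; last first.
      rewrite subshape_row_ge //; apply/esym/eqP; rewrite -leqn0 -GE -lama.
      by apply: leq_trans (Gle j) (lamle _ _ gej).
    have ej : j = Ordinal ltj :> nat by [].
    have key (k : 'I_b) : (k < subshape_row n (up h) j)%N = (k < g j)%N.
      rewrite {1}ej (lt_subshape_row _ _ _ uP) upE /= -GE.
      case: (ltnP k (G j)) => ltG.
        by rewrite (leq_trans ltG (Gle _)) (h1 (Ordinal ltj, k)).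
      by rewrite (h2 (Ordinal ltj, k)) //; case: ifP; lia.
    apply/eqP; rewrite eqn_leq; apply/andP; split; apply: leq_of_ltn.
    - exact: subshape_row_le.
    - by move=> k; rewrite key.
    - by rewrite -ltnS.
    - by move=> k; rewrite key.
  move=> c; apply: val_inj; rewrite /= dnE upE; case: ltnP => lt.
    exact/minn_idPl.
  by rewrite h2 ?(leq_trans (Gle _)) //; lia.
move=> /andP[/andP[uP /eqP sg] /eqP dh].
have [h1 h2 h3 h4] := ssytP _ _ _ uP.
rewrite (bigID (fun c : 'I_a * 'I_b => (c.2 < G c.1)%N)) /= mulrC; congr (_ * _).
  have -> : \prod_(c : 'I_a * 'I_b | (c.2 < lam c.1)%N && ~~ (c.2 < G c.1)%N) x (up h c) =
            \prod_(c : 'I_a * 'I_b | (c.2 < lam c.1)%N && ~~ (c.2 < G c.1)%N) x n.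
    apply: eq_bigr => -[i k] /= /andP[ltl geG]; congr (x _).
    apply/eqP; rewrite eqn_leq -ltnS (h1 (i, k)) //=.
    case: (ltnP i n) => lti.
      by rewrite leqNgt -(lt_subshape_row _ _ _ uP) -(shpE _ (Ordinal lti)) sg -GE.
    exact: leq_trans lti (ssyt_ge_row dec uP ltl).
  rewrite -(pair_big_dep xpredT (fun (i : 'I_a) (k : 'I_b) =>
    (k < lam i)%N && ~~ (k < G i)%N) (fun _ _ => x n)) /=.
  under eq_bigr => i _.
    have -> : \prod_(k < b | (k < lam i)%N && ~~ (k < G i)%N) x n = x n ^+ (lam i - G i).
      rewrite -prodr_const_nat big_geq_mkord (big_ord_widen_cond b _ (fun=> x n)) //.
      by apply: eq_bigl => k; rewrite -leqNgt andbC.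
    over.
  rewrite prodrXr; congr (_ ^+ _).
  rewrite (sum_ord_supp (F := fun i => (lam i - G i)%N) (m := n.+1)); first last.
  - by move=> j /lamle; rewrite lamn leqn0 => /eqP ->.
  - by move=> j /lamle; rewrite lama leqn0 => /eqP ->.
  rewrite big_ord_recr /= G0 // subn0 addnC; congr (_ + _)%N.
  by apply: eq_bigr => j _; rewrite GE.
apply: eq_big => [c|c /andP[ltl ltG]]; first by rewrite andb_idl // => /leq_trans; apply.
by congr (x _); rewrite upE ltl.
Qed.

(** [alt_branch] and [tab_branch] are the same recursion up to the product of the [x i - x n]. That
    product is supplied by the alternant of the zero shape, which is interlaced by the zero shape
    alone. *)
Lemma bialternant n lam : (n <= q)%N ->
    (forall j, lam j.+1 <= lam j)%N -> (lam 0 <= b)%N -> lam a = 0%N ->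
    lam n = 0%N ->
  alt x n (fun=> 0%N) * tab n lam = alt x n lam.
Proof.
elim: n lam => [|n IH] lam leq_q dec leb lama lamn.
  have lam0 j : lam j = 0%N.
    by apply/eqP; rewrite -leqn0 -lamn (decr_le dec).
  rewrite /alt !det_mx00 mul1r /tab (big_pred1 [ffun=> ord0]) /=.
    by rewrite big1 // => c; rewrite lam0.
  move=> f; apply/ssytP/eqP => [[_ h2 _ _]|->].
    by apply/ffunP => c; apply: val_inj; rewrite ffunE /= h2 // lam0.
  by split=> [c|c|i k k'|i i' k]; rewrite ?ffunE ?lam0.
rewrite tab_branch // (@alt_branch _ x n b.+1 lam) //.
rewrite (@alt_branch _ x n b.+1 (fun=> 0%N)) //.
rewrite (big_pred1 [ffun=> ord0]) => [|g]; last first.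
  apply/forallP/eqP => [h|-> j]; last by rewrite ffunE.
  by apply/ffunP => j; apply: val_inj; rewrite ffunE /=;
    have := h j; rewrite leqn0 => /andP[_ /eqP].
rewrite [(\sum_(j < n) (0 - _))%N]big1 // expr0 mul1r -!mulrA; congr (_ * _); rewrite big_distrr /=.
apply: eq_bigr => g /forallP gP; rewrite mulrCA; congr (_ * _).
have Gle j : (ext (fun j => nat_of_ord (g j)) j <= lam j)%N.
  case: (ltnP j n) => [h|h]; last by rewrite ext_ge.
  by rewrite (extE _ (Ordinal h)); have /andP[] := gP (Ordinal h).
rewrite (_ : alt x n (ext _) = alt x n (fun=> 0%N)); last first.
  by apply: eq_alt => j ltj; rewrite (extE _ (Ordinal ltj)) ffunE.
apply: IH.
- exact: ltnW.
- move=> j; case: (ltnP j.+1 n) => [h|h]; last by rewrite ext_ge.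
  rewrite (extE _ (Ordinal h)) (extE _ (Ordinal (ltnW h))).
  have /andP[_ le1] := gP (Ordinal h); have /andP[le2 _] := gP (Ordinal (ltnW h)).
  exact: leq_trans le1 le2.
- exact: leq_trans (Gle 0%N) leb.
- by apply/eqP; rewrite -leqn0 -lama Gle.
- by rewrite ext_ge.
Qed.

End Tableaux.

(** * Chains of partitions *)

Lemma is_partitionP mu : reflect
  ((forall i, (nth 0 mu i.+1 <= nth 0 mu i)%N) /\
   (forall i, (i < size mu)%N -> (0 < nth 0 mu i)%N)) (is_partition mu).
Proof.
apply: (iffP andP) => [[/(sortedP 0%N) srt n0]|[h1 h2]]; split.
- move=> i; case: (ltnP i.+1 (size mu)) => [/srt //|h].
  by rewrite (nth_default _ h).
- by move=> i lti; rewrite lt0n; apply: contraNneq n0 => <-; apply: mem_nth.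
- by apply/(sortedP 0%N) => i _; apply: h1.
- by apply/negP => /(nthP 0%N)[i lti e]; have := h2 i lti; rewrite e.
Qed.

Lemma is_partition_incr mu j : is_partition mu ->
  is_partition (incr_nth mu j) =
  (j == 0%N) || (nth 0 mu j < nth 0 mu j.-1)%N.
Proof.
move=> /is_partitionP[h1 h2]; apply/is_partitionP/idP => [[k1 k2]|].
  case: j k1 k2 => // j k1 _ /=; have := k1 j.
  by rewrite !nth_incr_nth eqxx (gtn_eqF (ltnSn j)).
move=> hj.
have lej : (j <= size mu)%N.
  case/predU1P: hj => [->//|]; case: j => // j /= lt.
  by rewrite ltnNge; apply/negP => h; rewrite (nth_default 0%N (n := j)) // in lt.
split=> i; rewrite !nth_incr_nth.
  case: (eqVneq j i.+1) hj => [-> /=|_ _]; last by rewrite add0n; apply: leq_trans (leq_addl _ _).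
  by rewrite (gtn_eqF (ltnSn i)).
rewrite size_incr_nth; case: (eqVneq j i) => // neq; rewrite add0n; case: ifP => [_ /h2//|_].
by rewrite ltnS leq_eqVlt eq_sym (negPf neq) /= => lt; apply: h2; apply: leq_trans lej.
Qed.

Section SetsByMinimum.
Variables (V : nmodType) (n : nat).

(** Lists a set of rows in increasing order, one element at a time. This links sums over sets, as in
    e_c and the Pieri rule, to the recursive sums over words and chains. *)
Lemma big_set_min (g : {set 'I_n} -> V) c L :
  \sum_(S : {set 'I_n} | (#|S| == c.+1) && [forall i in S, (L <= i)%N]) g S =
  \sum_(j < n | (L <= j)%N)
     \sum_(S : {set 'I_n} | (#|S| == c) && [forall i in S, (j < i)%N]) g (j |: S).
Proof.
pose ismin (S : {set 'I_n}) (j : 'I_n) := (j \in S) && [forall i in S, (j <= i)%N].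
transitivity (\sum_(S : {set 'I_n} | (#|S| == c.+1) && [forall i in S, (L <= i)%N])
    \sum_(j | ismin S j) g S).
  apply: eq_bigr => S /andP[/eqP cS _].
  have /card_gt0P[i0 i0S] : (0 < #|S|)%N by rewrite cS.
  case: (arg_minnP (fun i : 'I_n => i : nat) i0S) => m mS mmin.
  rewrite (big_pred1 m) // => j; apply/andP/eqP => [[jS /forall_inP jmin]|->].
    by apply: val_inj; apply/eqP; rewrite eqn_leq jmin // mmin.
  by split=> //; apply/forall_inP.
rewrite (exchange_big_dep (fun j : 'I_n => (L <= j)%N)) /=; last first.
  by move=> S j /andP[_ /forall_inP h] /andP[/h].
apply: eq_bigr => j leLj.
rewrite (reindex_onto (fun S => j |: S) (fun S => S :\ j)) /=; last first.
  by move=> S /and3P[_ jS _]; rewrite setD1K.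
apply: eq_bigl => S; apply/idP/idP.
  case/andP=> /and3P[/andP[/eqP cS _] _ /forall_inP jmin] /eqP e.
  have jS : j \notin S by rewrite -e !inE eqxx.
  move: cS; rewrite cardsU1 jS add1n => -[->]; rewrite eqxx; apply/forall_inP => i iS.
  rewrite ltn_neqAle jmin ?inE ?iS ?orbT // andbT.
  by apply: contraNneq jS => /val_inj ->.
case/andP=> /eqP cS /forall_inP jmin.
have jS : j \notin S by apply/negP => /jmin; rewrite ltnn.
rewrite cardsU1 jS cS eqxx setU1K // eqxx /ismin !inE eqxx andbT /=.
apply/andP; split; apply/forall_inP => i; rewrite !inE => /predU1P[->|/jmin] //.
  by move/ltnW; apply: leq_trans.
exact: ltnW.
Qed.

Lemma big_set_ge0 (g : {set 'I_n} -> V) L :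
  \sum_(S : {set 'I_n} | (#|S| == 0%N) && [forall i in S, (L <= i)%N]) g S = g set0.
Proof.
rewrite (big_pred1 set0) // => S; rewrite cards_eq0 /=; have [->|] // := eqVneq S set0.
by apply/forall_inP => i; rewrite inE.
Qed.

End SetsByMinimum.

Section Words.
Variables (R : comNzRingType) (x : nat -> R) (n : nat).
Local Notation alt := (alt x n).

(* Consecutive letters i, j of the reading word of a ribbon: j is below i
   (Some true), j is to the left of i (Some false), or i and j belong to two
   unrelated ribbons (None). *)
Definition step (d : option bool) (i j : nat) : bool :=
  match d with None => true | Some true => (i < j)%N | Some false => (j <= i)%N end.

Fixpoint words (pat : seq (option bool)) (i : nat) : R :=
  if pat is d :: pat' then \sum_(j < n | step d i j) x j * words pat' j else 1.

(* Sum of k over the ends of the chains of partitions that start at mu and add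
   one box at a time, in rows following the pattern. *)
Fixpoint chains (pat : seq (option bool)) (k : seq nat -> R) (mu : seq nat) (i : nat) : R :=
  if pat is d :: pat' then
    \sum_(j < n | step d i j && is_partition (incr_nth mu j))
      chains pat' k (incr_nth mu j) j
  else k mu.

(** An intermediate form: the Pieri rule for alternants chooses rows without regard to the shape,
    and the surplus terms vanish afterwards. *)
Fixpoint free_chains (pat : seq (option bool)) (k : seq nat -> R) (mu : seq nat) (i : nat) : R :=
  if pat is d :: pat' then
    \sum_(j < n | step d i j) free_chains pat' k (incr_nth mu j) j
  else k mu.

Definition altp (mu : seq nat) : R := alt (nth 0%N mu).

(** As e_c is symmetric, each Leibniz term may use the image of [S] under its own permutation; the
    monomial then raises by one the exponents of exactly the rows in [S]. *)
Lemma pieri lam c :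
  alt lam * \sum_(S : {set 'I_n} | #|S| == c) \prod_(i in S) x i =
  \sum_(S : {set 'I_n} | #|S| == c) alt (fun j => lam j + ext (fun i => i \in S) j)%N.
Proof.
rewrite /alt /determinant big_distrl /=.
under [RHS]eq_bigr do under eq_bigr do under eq_bigr do rewrite mxE.
rewrite exchange_big /=; apply: eq_bigr => s _.
rewrite big_distrr (reindex (fun S : {set 'I_n} => s @: S)) /=; last first.
  exists (fun S : {set 'I_n} => s @^-1: S) => S _; apply/setP => i.
    by rewrite inE mem_imset //; apply: perm_inj.
  by rewrite -[i in LHS](permKV s) mem_imset ?inE ?permKV //; apply: perm_inj.
apply: eq_big => [S|S _]; first by rewrite card_imset //; apply: perm_inj.
rewrite -mulrA; congr (_ * _).
rewrite big_imset /=; last by move=> i j _ _; apply: perm_inj.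
rewrite [\prod_(i in S) _]big_mkcond -big_split /=; apply: eq_bigr => j _; rewrite mxE extE.
by case: (j \in S); rewrite ?addn0 ?mulr1 // addnAC addn1 exprSr.
Qed.

Lemma words_strict c i :
  words (nseq c (Some true)) i =
  \sum_(S : {set 'I_n} | (#|S| == c) && [forall j in S, (i < j)%N]) \prod_(j in S) x j.
Proof.
elim: c i => [|c IH] i /=; first by rewrite big_set_ge0 big_set0.
rewrite big_set_min; apply: eq_bigr => j _; rewrite IH big_distrr /=.
apply: eq_bigr => S /andP[_ /forall_inP jmin]; rewrite big_setU1 //.
by apply/negP => /jmin; rewrite ltnn.
Qed.

Lemma free_chains_strict c mu i :
  free_chains (nseq c (Some true)) altp mu i =
  \sum_(S : {set 'I_n} | (#|S| == c) && [forall j in S, (i < j)%N])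
     alt (fun j => nth 0%N mu j + ext (fun i => i \in S) j)%N.
Proof.
elim: c i mu => [|c IH] i mu /=.
  rewrite big_set_ge0; apply: eq_alt => j ltj.
  by rewrite (extE _ (Ordinal ltj)) inE addn0.
rewrite big_set_min; apply: eq_bigr => j _; rewrite IH.
apply: eq_bigr => S /andP[_ /forall_inP jmin]; apply: eq_alt => r ltr.
rewrite nth_incr_nth !(extE _ (Ordinal ltr)) !inE.
have jS : j \notin S by apply/negP => /jmin; rewrite ltnn.
rewrite -val_eqE /= [r == _]eq_sym; case: eqVneq => [e|_]; last by rewrite add0n.
by rewrite (_ : Ordinal ltr = j) ?(negPf jS) ?addn0 ?addn1 //; apply: val_inj.
Qed.

(** Later boxes lie strictly below row [i], so rows [r] and [r.+1] keep their equal exponents to the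
    end. *)
Lemma free_chains_eq0 c mu i r : (r.+1 <= i < n)%N ->
  nth 0%N mu r.+1 = (nth 0%N mu r).+1 -> free_chains (nseq c (Some true)) altp mu i = 0.
Proof.
elim: c mu i => [|c IH] mu i /andP[ltr lti] e /=.
  by apply: alt_eq0 e; apply: leq_ltn_trans lti.
rewrite big1 // => j ltij; apply: IH; first by rewrite ltn_ord andbT ltnW ?(leq_ltn_trans ltr).
by rewrite !nth_incr_nth !gtn_eqF ?add0n //; apply: leq_ltn_trans ltij; rewrite // ltnW.
Qed.

(* A box that destroys the partition shape leaves two equal exponents, and
   the boxes added below it cannot repair this. *)
Lemma chains_strict d c mu i : is_partition mu ->
  chains (d :: nseq c (Some true)) altp mu i =
  free_chains (d :: nseq c (Some true)) altp mu i.
Proof.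
elim: c d mu i => [|c IH] d mu i muP; rewrite [LHS]/= [RHS]/= big_mkcondr;
  apply: eq_bigr => j _; case: ifP => partj //; try exact: (IH (Some true) _ _ partj); symmetry.
all: move: partj; rewrite is_partition_incr //; have := ltn_ord j.
all: case ej: (j : nat) => [//|r] ltr /= /negbT; rewrite -leqNgt => le.
all: have e : nth 0%N (incr_nth mu r.+1) r.+1 = (nth 0%N (incr_nth mu r.+1) r).+1
  by rewrite !nth_incr_nth eqxx (gtn_eqF (ltnSn r)) add0n; congr _.+1;
     apply/eqP; rewrite eqn_leq le; have /is_partitionP[-> _] := muP.
  exact: (alt_eq0 x ltr e).
by apply: (@free_chains_eq0 c.+1 _ _ r _ e); rewrite leqnn.
Qed.

(** The sum over words is e_(c+1), and the boxes of a vertical strip have exactly one order from top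
    to bottom. *)
Lemma pieri_chains c mu i : is_partition mu ->
  altp mu * words (None :: nseq c (Some true)) i =
  chains (None :: nseq c (Some true)) altp mu i.
Proof.
move=> muP; rewrite chains_strict //=.
have e0 (g : {set 'I_n} -> R) : \sum_(S : {set 'I_n} | #|S| == c.+1) g S =
    \sum_(j < n) \sum_(S : {set 'I_n} | (#|S| == c) && [forall i in S, (j < i)%N]) g (j |: S).
  rewrite -(big_set_min g c 0); apply: eq_bigl => S.
  by rewrite andb_idr // => _; apply/forall_inP.
have -> : \sum_(j < n) x j * words (nseq c (Some true)) j =
    \sum_(S : {set 'I_n} | #|S| == c.+1) \prod_(i in S) x i.
  rewrite e0; apply: eq_bigr => j _; rewrite words_strict big_distrr /=.
  apply: eq_bigr => S /andP[_ /forall_inP jmin]; rewrite big_setU1 //.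
  by apply/negP => /jmin; rewrite ltnn.
rewrite pieri e0; apply: eq_bigr => j _; rewrite free_chains_strict.
apply: eq_bigr => S /andP[_ /forall_inP jmin]; apply: eq_alt => r ltr.
rewrite nth_incr_nth !(extE _ (Ordinal ltr)) !inE.
have jS : j \notin S by apply/negP => /jmin; rewrite ltnn.
rewrite -val_eqE /= [r == _]eq_sym; case: eqVneq => [e|_]; last by rewrite add0n.
by rewrite (_ : Ordinal ltr = j) ?(negPf jS) ?addn0 ?addn1 //; apply: val_inj.
Qed.

Lemma words_cat_free pre post i :
  words (pre ++ None :: post) i = words pre i * words (None :: post) 0.
Proof.
elim: pre i => [|d pre IH] i /=; first by rewrite mul1r.
by rewrite big_distrl; apply: eq_bigr => j _; rewrite IH mulrA.
Qed.

Lemma chains_cat_free pre post k mu i :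
  chains (pre ++ None :: post) k mu i =
  chains pre (fun nu => chains (None :: post) k nu 0) mu i.
Proof. by elim: pre mu i => //= d pre IH mu i; apply: eq_bigr => j _; apply: IH. Qed.

Lemma words_split pre post i :
  words (pre ++ None :: post) i =
  words (pre ++ Some true :: post) i + words (pre ++ Some false :: post) i.
Proof.
elim: pre i => [|d pre IH] i /=.
  rewrite (bigID (fun j : 'I_n => (i < j)%N)) /=; congr (_ + _).
  by apply: eq_bigl => j; rewrite -leqNgt.
by rewrite -big_split /=; apply: eq_bigr => j _; rewrite IH mulrDr.
Qed.

Lemma chains_split pre post k mu i :
  chains (pre ++ None :: post) k mu i =
  chains (pre ++ Some true :: post) k mu i + chains (pre ++ Some false :: post) k mu i.
Proof.
elim: pre mu i => [|d pre IH] mu i /=.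
  rewrite (bigID (fun j : 'I_n => (i < j)%N)) /=; congr (_ + _).
    by apply: eq_bigl => j; rewrite andbC.
  by apply: eq_bigl => j; rewrite -leqNgt andbC.
by rewrite -big_split /=; apply: eq_bigr => j _; rewrite IH.
Qed.

Lemma chains_mulr pat k k' C mu i :
    (forall nu, is_partition nu -> k nu = k' nu * C) -> is_partition mu ->
  chains pat k mu i = chains pat k' mu i * C.
Proof.
move=> kk'; elim: pat mu i => [|d pat IH] mu i muP /=; first exact: kk'.
by rewrite big_distrl; apply: eq_bigr => j /andP[_ /IH].
Qed.

(* Induction on the number of left steps: a left step is an unconstrained
   step minus a down step, and an unconstrained step splits off a factor. *)
Lemma chains_words (pat : seq bool) mu i : is_partition mu ->
  altp mu * words (None :: map Some pat) i = chains (None :: map Some pat) altp mu i.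
Proof.
(* The [c] down steps are the block read so far. The statement must hold for all [c], because a
   further down step is absorbed by passing to [c.+1]. *)
suff gen c : is_partition mu ->
    altp mu * words (None :: nseq c (Some true) ++ map Some pat) i =
    chains (None :: nseq c (Some true) ++ map Some pat) altp mu i by apply: (gen 0%N).
elim: pat c mu i => [|d pat IH] c mu i muP; first by rewrite cats0 pieri_chains.
have down : altp mu * words (None :: nseq c (Some true) ++ Some true :: map Some pat) i =
    chains (None :: nseq c (Some true) ++ Some true :: map Some pat) altp mu i.
  by have := IH c.+1 mu i muP; rewrite -[c.+1]addn1 nseqD -catA.
case: d => //.
have ew := words_split (None :: nseq c (Some true)) (map Some pat) i.
have ec := chains_split (None :: nseq c (Some true)) (map Some pat) altp mu i.
apply: (addrI (altp mu * words (None :: nseq c (Some true) ++ Some true :: map Some pat) i)).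
rewrite [in RHS]down -mulrDr -!cat_cons -ew -ec words_cat_free chains_cat_free.
rewrite mulrA pieri_chains //; symmetry; apply: chains_mulr => // nu nuP.
by rewrite -(IH 0%N).
Qed.

End Words.

(** * Ribbons as words *)

(** The variables extended by 0, since alternants, tableaux and words take variables indexed by all
    natural numbers. *)
Definition xvar n (i : nat) : {mpoly int[n]} := if insub i is Some j then 'X_j else 0.

Lemma xvarE n (i : 'I_n) : xvar n i = 'X_i.
Proof. by rewrite /xvar valK. Qed.

Section SchurTableaux.
Variables (la : seq nat) (n : nat).
Local Notation box := (skew_box la [::]).
Local Notation arr := {ffun 'I_(size la) * 'I_(head 0%N la) -> 'I_n.+1}.

Lemma in_straight i j : in_skew la [::] i j = (j < nth 0%N la i)%N.
Proof. by rewrite /in_skew nth_nil. Qed.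

Definition array_of (T : {ffun box -> 'I_n}) : arr :=
  [ffun c => if insub c is Some c' then widen_ord (leqnSn n) (T c') else ord_max].

Lemma array_of_box T (c : box) : array_of T (val c) = T c :> nat.
Proof. by rewrite ffunE valK. Qed.

Lemma array_of_out T (c : 'I_(size la) * 'I_(head 0%N la)) :
  (nth 0%N la c.1 <= c.2)%N -> array_of T c = n :> nat.
Proof. by move=> h; rewrite ffunE insubN //= in_straight -leqNgt. Qed.

Lemma array_of_inj : injective array_of.
Proof.
move=> T T' e; apply/ffunP => c; apply: val_inj.
by rewrite /= -!array_of_box e.
Qed.

Lemma schur_tab : is_partition la ->
  schur la n = tab (xvar n) (size la) (head 0%N la) n n (nth 0%N la).
Proof.
move=> /is_partitionP[dec _]; have lale := decr_le dec.
rewrite /schur /skew_schur /tab.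
have eS : [set f : arr | ssyt n (nth 0%N la) f] =
    array_of @: [set T | semistandard T].
  apply/setP => f; rewrite inE; apply/idP/imsetP => [fP|[T]].
    have [h1 h2 h3 h4] := ssytP _ _ _ fP.
    have lt (c : box) : (f (val c) < n)%N by apply: h1; rewrite -in_straight; apply: (valP c).
    pose T : {ffun box -> 'I_n} := [ffun c => Ordinal (lt c)].
    have TE (c : box) : T c = f (val c) :> nat by rewrite ffunE.
    exists T; last first.
      apply/ffunP => c; apply: val_inj; case: (ltnP c.2 (nth 0%N la c.1)) => [ltc|gec].
        rewrite -in_straight in ltc; rewrite -[c]/(val (exist _ c ltc : box)).
        by rewrite [RHS]array_of_box TE.
      by rewrite /= array_of_out // h2.
    rewrite inE; apply/forallP => -[[i k] hc]; apply/forallP => -[[i' k'] hd].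
    rewrite !TE /brow /bcol /=; apply/andP; split; apply/implyP => /andP[].
      by move=> /eqP/val_inj -> le; apply: h3.
    by move=> /eqP/val_inj -> lt'; apply: h4 => //; rewrite -in_straight.
  rewrite inE => /forallP sT ->.
  apply/ssytP; split=> [c ltc|c gec|i k k' le|i i' k lt ltl].
  - rewrite -in_straight in ltc; rewrite -[c]/(val (exist _ c ltc : box)).
    by rewrite array_of_box.
  - exact: array_of_out.
  - case: (ltnP k' (nth 0%N la i)) => lt'; last first.
      by rewrite (array_of_out T (c := (i, k'))) // -ltnS.
    have hk : in_skew la [::] i k by rewrite in_straight (leq_ltn_trans le).
    rewrite -in_straight in lt'.
    rewrite -[(i, k)]/(val (exist _ (i, k) hk : box)).
    rewrite -[(i, k')]/(val (exist _ (i, k') lt' : box)) !array_of_box.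
    have /forallP/(_ (exist _ (i, k') lt')) := sT (exist _ (i, k) hk).
    by rewrite /brow /bcol /= eqxx le => /andP[].
  - have lt' : (k < nth 0%N la i)%N by apply: leq_trans ltl (lale _ _ (ltnW lt)).
    rewrite -in_straight in ltl; rewrite -in_straight in lt'.
    rewrite -[(i, k)]/(val (exist _ (i, k) lt' : box)).
    rewrite -[(i', k)]/(val (exist _ (i', k) ltl : box)) !array_of_box.
    have /forallP/(_ (exist _ (i', k) ltl)) := sT (exist _ (i, k) lt').
    by rewrite /brow /bcol /= eqxx lt => /andP[].
transitivity (\sum_(f in array_of @: [set T | semistandard T])
    \prod_(c : 'I_(size la) * 'I_(head 0%N la) | (c.2 < nth 0%N la c.1)%N) xvar n (f c)).
  rewrite big_imset /=; last by move=> T T' _ _; apply: array_of_inj.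
  apply: eq_big => [T|T _]; first by rewrite inE.
  rewrite [RHS](reindex_omap (val : box -> _) insub) /=; last first.
    by move=> c ltc; rewrite -in_straight in ltc; rewrite insubT.
  apply: eq_big => [c|c _]; last by rewrite array_of_box xvarE.
  by rewrite valK eqxx andbT -in_straight; symmetry; apply: (valP c).
by rewrite -eS; apply: eq_bigl => f; rewrite inE.
Qed.

(** Strict columns force the entries of row [n] to be at least [n]. *)
Lemma schur_eq0 : is_partition la -> (n < size la)%N -> schur la n = 0.
Proof.
move=> laP ltn; rewrite schur_tab // /tab big_pred0 // => f; apply/negP => fP.
have /is_partitionP[dec pos] := laP.
have lt0 : (0 < head 0%N la)%N by rewrite -nth0 pos // (leq_ltn_trans _ ltn).
have := ssyt_ge_row (i := Ordinal ltn) (k := Ordinal lt0) dec fP (pos _ ltn).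
by have [h1 _ _ _] := ssytP _ _ _ fP; rewrite leqNgt h1 //= pos.
Qed.

Lemma schur_bialternant : is_partition la -> (size la <= n)%N ->
  altp (xvar n) n [::] * schur la n = altp (xvar n) n la.
Proof.
move=> laP len; rewrite schur_tab // /altp.
rewrite (@eq_alt _ _ n (nth 0%N [::]) (fun=> 0%N)); last by move=> j _; rewrite nth_nil.
have /is_partitionP[dec _] := laP.
by apply: bialternant; rewrite ?nth0 ?nth_default.
Qed.

End SchurTableaux.

(** The steps between consecutive boxes, [true] for down and [false] for left. The first box follows
    no step; it is the [None] put in front of the pattern later. *)
Fixpoint ribbon_pattern (al : seq nat) : seq bool :=
  if al is p :: al' then
    nseq p.-1 false ++ (if al' is [::] then [::] else true :: ribbon_pattern al')
  else [::].

Section RibbonGeometry.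
Local Open Scope nat_scope.

(* The boxes of a ribbon are numbered along the ribbon from its top right end;
   width al is the column of box number 0. *)
Definition width (al : seq nat) := sumn (map predn al).

Definition row_at al t := count id (take t (ribbon_pattern al)).
Definition lefts_at al t := count negb (take t (ribbon_pattern al)).

Lemma ribbon_outer_cons p al : ribbon_outer (p :: al) = (width (p :: al)).+1 :: ribbon_outer al.
Proof. by rewrite /ribbon_outer /mkseq /= (iotaDl 1) -map_comp. Qed.

Lemma ribbon_inner_cons p al : ribbon_inner (p :: al) = width al :: ribbon_inner al.
Proof. by rewrite /ribbon_inner /mkseq /= drop0 (iotaDl 1) -map_comp. Qed.

Lemma in_ribbon_cons p al i j :
  in_skew (ribbon_outer (p :: al)) (ribbon_inner (p :: al)) i j =
  if i is i'.+1 then in_skew (ribbon_outer al) (ribbon_inner al) i' j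
  else width al <= j <= p.-1 + width al.
Proof. by rewrite ribbon_outer_cons ribbon_inner_cons; case: i. Qed.

Lemma in_ribbon_nil i j : in_skew (ribbon_outer [::]) (ribbon_inner [::]) i j = false.
Proof. by rewrite /in_skew !nth_nil andbF. Qed.

Lemma row_lefts al t : t <= size (ribbon_pattern al) -> row_at al t + lefts_at al t = t.
Proof.
move=> le; rewrite /row_at /lefts_at -[RHS](size_takel le) -(count_predC id).
by congr (_ + _); apply: eq_count.
Qed.

(** The number of a box is the number of steps leading to it: [i] down and [width al - j] to the
    left. *)
Lemma in_ribbon_pos al i j : in_skew (ribbon_outer al) (ribbon_inner al) i j ->
  [/\ j <= width al, i + (width al - j) <= size (ribbon_pattern al) &
      row_at al (i + (width al - j)) = i].
Proof.
elim: al i => [|p al IH] i; first by rewrite in_ribbon_nil.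
rewrite in_ribbon_cons; case: i => [|i].
  rewrite /width /= -/(width al) => /andP[h1 h2]; split=> //.
    by rewrite size_cat size_nseq; lia.
  rewrite /row_at /= take_cat size_nseq; case: ifP => h.
    by rewrite take_nseq ?count_nseq; lia.
  have -> : 0 + (p.-1 + width al - j) - p.-1 = 0 by lia.
  by rewrite take0 cats0 count_nseq.
move=> h; have [h1 h2 h3] := IH _ h.
rewrite /width /= -/(width al).
have -> : i.+1 + (p.-1 + width al - j) = p.-1 + (i + (width al - j)).+1 by lia.
case: al IH h h1 h2 h3 => [|q al] IH h h1 h2 h3; first by rewrite in_ribbon_nil in h.
split; first by lia.
  by rewrite size_cat size_nseq leq_add2l.
rewrite /row_at take_cat size_nseq ltnNge leq_addr /= addKn count_cat count_nseq /= mul0n add0n add1n;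
  congr _.+1.
exact: h3.
Qed.

Lemma pos_in_ribbon al t : al != [::] -> t <= size (ribbon_pattern al) ->
  in_skew (ribbon_outer al) (ribbon_inner al) (row_at al t) (width al - lefts_at al t).
Proof.
elim: al t => // p al IH t _ le; rewrite in_ribbon_cons.
rewrite /row_at /lefts_at /= take_cat size_nseq; case: ifP => h.
  by rewrite take_nseq ?(ltnW h) // !count_nseq /= /width /= -/(width al); lia.
rewrite !count_cat !count_nseq /= /width /= -/(width al).
have [d ed] : exists d, t = p.-1 + d by exists (t - p.-1); lia.
move: le; rewrite ed addKn /= size_cat size_nseq leq_add2l.
case: al IH => [|q al] IH /=; first by rewrite /width /=; lia.
case: d {h ed} => [|d] le /=; first lia.
rewrite mul1n -[count negb _]/(lefts_at (q :: al) d).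
have -> : p.-1 + width (q :: al) - (p.-1 + (0 + lefts_at (q :: al) d)) =
   width (q :: al) - lefts_at (q :: al) d by lia.
by rewrite add0n; apply: IH.
Qed.

Lemma row_at_nth al t : t < size (ribbon_pattern al) ->
  row_at al t.+1 = row_at al t + nth false (ribbon_pattern al) t.
Proof. by move=> lt; rewrite /row_at (take_nth false lt) -cats1 count_cat /= addn0. Qed.

End RibbonGeometry.

Fixpoint follows (pat : seq (option bool)) (i : nat) (w : seq nat) : bool :=
  match pat, w with
  | d :: pat', j :: w' => step d i j && follows pat' j w'
  | [::], [::] => true
  | _, _ => false
  end.

Lemma followsP pat i w : size w = size pat -> reflect
  (forall t, (t < size pat)%N ->
     step (nth None pat t) (nth 0%N (i :: w) t) (nth 0%N w t))
  (follows pat i w).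
Proof.
elim: pat i w => [|d pat IH] i [|j w] //= => [_|[e]]; first by constructor.
apply: (iffP andP) => [[h1 /(IH _ _ e) h2] [|t] //|h]; first exact: h2.
by split; [apply: (h 0%N) | apply/IH => // t; apply: (h t.+1)].
Qed.

Lemma words_sum (R : comNzRingType) (x : nat -> R) n pat i :
  words x n pat i =
  \sum_(w : (size pat).-tuple 'I_n | follows pat i (map val w)) \prod_(j <- w) x j.
Proof.
elim: pat i => [|d pat IH] i /=.
  by rewrite (big_pred1 [tuple]) ?big_nil // => w; rewrite [w]tuple0.
under eq_bigr do rewrite IH big_distrr /=.
rewrite (pair_big_dep (fun j : 'I_n => step d i j)
  (fun (j : 'I_n) (w : (size pat).-tuple 'I_n) => follows pat j (map val w))) /=.
rewrite (reindex (fun w : (size pat).+1.-tuple 'I_n => (thead w, [tuple of behead w]))) /=.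
  by apply: eq_big => [w|w _]; case/tupleP: w => j w; rewrite /= ?big_cons theadE.
exists (fun p => cons_tuple p.1 p.2) => [w _|[j w] _].
  by case/tupleP: w => j w; apply: val_inj.
by congr pair; rewrite ?theadE //; apply: val_inj.
Qed.

Lemma lefts_at_le al t : (lefts_at al t <= width al)%N.
Proof.
have -> : width al = count negb (ribbon_pattern al).
  elim: al => // p [|q al] IH; first by rewrite /width /= cats0 count_nseq /=; lia.
  rewrite -[LHS]/(p.-1 + width (q :: al))%N IH.
  rewrite -[ribbon_pattern [:: p, q & al]]/(nseq p.-1 false ++ true :: ribbon_pattern (q :: al)).
  by rewrite count_cat count_nseq mul1n.
by rewrite /lefts_at -{2}(cat_take_drop t (ribbon_pattern al)) count_cat leq_addr.
Qed.

Section Monotone.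
Local Open Scope nat_scope.
Variables (al : seq nat) (V : nat -> nat).
Hypothesis VP : forall t, t < size (ribbon_pattern al) ->
  step (Some (nth false (ribbon_pattern al) t)) (V t) (V t.+1).

Lemma row_at_bounds t k : t + k <= size (ribbon_pattern al) ->
  row_at al t <= row_at al (t + k) <= row_at al t + k.
Proof.
elim: k => [|k IH]; first by rewrite !addn0 leqnn.
rewrite addnS => lt; rewrite row_at_nth //.
by have := IH (ltnW lt); case: (nth _ _ _) => /=; lia.
Qed.

Lemma row_weak t k : t + k <= size (ribbon_pattern al) ->
  row_at al (t + k) = row_at al t -> V (t + k) <= V t.
Proof.
elim: k => [|k IH]; first by rewrite addn0.
rewrite addnS => lt; rewrite row_at_nth //.
have := VP lt; have := row_at_bounds (ltnW lt); have := IH (ltnW lt).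
case: (nth _ _ _) => /=; first lia.
by rewrite addn0 => h _ h2 /h; apply: leq_trans.
Qed.

Lemma column_strict t k : t + k.+1 <= size (ribbon_pattern al) ->
  row_at al (t + k.+1) = row_at al t + k.+1 -> V t < V (t + k.+1).
Proof.
elim: k => [|k IH]; rewrite addnS => lt; rewrite row_at_nth //;
  have := VP lt; have := row_at_bounds (ltnW lt).
  by rewrite addn0; case: (nth _ _ _) => //=; lia.
have := IH (ltnW lt); case: (nth _ _ _) => /=; last by lia.
by move=> h _ h2 e; apply: leq_trans h2; apply: ltnW; apply: h; lia.
Qed.

End Monotone.

(** Semistandardness compares any two boxes of a row or column, a word only neighbours. In a ribbon
    the boxes of one row, or of one column, have consecutive numbers, so neighbours suffice. *)
Lemma ribbon_words al n : al != [::] ->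
  ribbon_schur al n = words (xvar n) n (None :: map Some (ribbon_pattern al)) 0.
Proof.
move=> al0; rewrite /ribbon_schur /skew_schur words_sum /= size_map.
set M := size (ribbon_pattern al).
set la := ribbon_outer al; set mu := ribbon_inner al.
have boxP (t : 'I_M.+1) : exists c : skew_box la mu,
    (brow c == row_at al t) && (bcol c == width al - lefts_at al t)%N.
  have := pos_in_ribbon al0 (ltn_ord t : (t <= M)%N).
  by case/(box_exists (ribbon_outer_part al)) => c [e1 e2]; exists c; rewrite e1 e2 !eqxx.
pose box t : skew_box la mu := xchoose (boxP t).
have boxE t : brow (box t) = row_at al t /\ bcol (box t) = (width al - lefts_at al t)%N.
  by have /andP[/eqP ? /eqP ?] := xchooseP (boxP t).
have posP (c : skew_box la mu) := in_ribbon_pos (valP c : in_skew la mu (brow c) (bcol c)).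
pose pos (c : skew_box la mu) : 'I_M.+1 := inord (brow c + (width al - bcol c)).
have posE c : pos c = (brow c + (width al - bcol c))%N :> nat.
  by rewrite inordK //; have [] := posP c.
have posrow c : row_at al (pos c) = brow c by rewrite posE; have [] := posP c.
have boxK : cancel box pos.
  move=> t; apply: val_inj; rewrite /= posE; have [-> ->] := boxE t.
  by rewrite subKn ?lefts_at_le // (row_lefts (ltn_ord t : (t <= M)%N)).
have posK : cancel pos box.
  move=> c; have [e1 e2] := boxE (pos c).
  have [h1 h2 h3] := posP c.
  have := row_lefts (ltn_ord (pos c) : (pos c <= M)%N).
  rewrite posrow in e1 *; rewrite [RHS]posE => /addnI el.
  rewrite el subKn // in e2.
  by apply: val_inj; rewrite [LHS]surjective_pairing [RHS]surjective_pairing;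
    congr pair; apply: val_inj.
rewrite (reindex (fun w : M.+1.-tuple 'I_n => [ffun c => tnth w (pos c)])) /=; last first.
  exists (fun T : {ffun skew_box la mu -> 'I_n} => [tuple T (box t) | t < M.+1]) => [w|T] _.
    by apply: eq_from_tnth => t; rewrite tnth_mktuple ffunE boxK.
  by apply/ffunP => c; rewrite ffunE tnth_mktuple posK.
apply: eq_big => [w|w _]; last first.
  rewrite big_tuple (reindex pos) /=; last by exists box => ? _; [apply: posK | apply: boxK].
  by apply: eq_bigr => c _; rewrite ffunE xvarE.
pose V t := nth 0%N (map val w) t.
have VE (t : 'I_M.+1) : tnth w t = V t :> nat.
  by rewrite /V (nth_map (tnth w t)) ?size_tuple // -tnth_nth.
have szw : size (map val w) = size (None :: map Some (ribbon_pattern al)).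
  by rewrite size_map size_tuple /= size_map.
apply/forallP/(followsP 0 szw) => [sT [|t] //|fw].
  rewrite /= size_map ltnS => lt; rewrite (nth_map false) //.
  have := sT (box (inord t)); have [] := boxE (inord t); rewrite inordK ?(leqW lt) // => r1 c1.
  move=> /forallP/(_ (box (inord t.+1))); have [] := boxE (inord t.+1); rewrite inordK // => r2 c2.
  have /forallP/(_ (box (inord t))) := sT (box (inord t.+1)).
  rewrite !ffunE !boxK !VE !inordK ?(leqW lt) // r1 r2 c1 c2 row_at_nth //.
  have := row_lefts (ltnW lt); have := row_lefts lt; rewrite row_at_nth //.
  rewrite /V; case: (nth _ _ _) => /= e1 e2.
    have -> : lefts_at al t.+1 = lefts_at al t by lia.
    by rewrite eqxx addn1 ltnSn /= => _ /andP[_].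
  rewrite addn0 eqxx /=; have -> : lefts_at al t.+1 = (lefts_at al t).+1 by lia.
  by rewrite leq_sub2l //= => /andP[].
have VP t : (t < M)%N -> step (Some (nth false (ribbon_pattern al) t)) (V t) (V t.+1).
  by move=> lt; have := fw t.+1; rewrite /= size_map ltnS (nth_map false) //; apply.
move=> c; apply/forallP => d; rewrite !ffunE !VE.
have pc := ltn_ord (pos c); have pd := ltn_ord (pos d).
have [c1 _ _] := posP c; have [d1 _ _] := posP d.
apply/andP; split; apply/implyP => /andP[/eqP e le].
  (* Rows are read from right to left, so the box further right comes first. *)
  have lep : (pos d <= pos c)%N by rewrite !posE; lia.
  by rewrite -(subnKC lep); apply: (row_weak VP); rewrite subnKC // !posrow.
have ltp : (pos c < pos d)%N by rewrite !posE; lia.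
have ep : (pos d = pos c + (pos d - pos c).-1.+1 :> nat)%N by lia.
by rewrite [X in (_ < V X)%N]ep; apply: (column_strict VP); rewrite -ep // !posrow !posE; lia.
Qed.

(** * Evaluation of the chains *)

Section ChainRange.
Variables (R : comNzRingType) (n M : nat) (k k' : seq nat -> R).
Hypothesis le_nM : (n <= M)%N.
Hypothesis k_small : forall nu, is_partition nu -> (size nu <= n)%N -> k nu = k' nu.
Hypothesis k_large : forall nu, is_partition nu -> (n < size nu)%N -> k' nu = 0.

Lemma chains_large pat mu i : is_partition mu -> (n < size mu)%N ->
  chains M pat k' mu i = 0.
Proof.
elim: pat mu i => [|d pat IH] mu i muP lt /=; first exact: k_large.
rewrite big1 // => j /andP[_ muP']; apply: IH => //.
by rewrite size_incr_nth; case: ifP => // h; lia.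
Qed.

(** A chain that enters a row beyond the first [n] ends in a shape with more than [n] rows, where
    [k'] is 0. *)
Lemma chains_widen pat mu i : is_partition mu -> (size mu <= n)%N ->
  chains n pat k mu i = chains M pat k' mu i.
Proof.
elim: pat mu i => [|d pat IH] mu i muP le /=; first exact: k_small.
pose F j := chains M pat k' (incr_nth mu j) j.
rewrite [RHS](bigID (fun j : 'I_M => (j < n)%N)) /= [X in _ = _ + X]big1 ?addr0; last first.
  move=> j /andP[/andP[_ muP'] ge]; apply: chains_large => //.
  by rewrite size_incr_nth; case: ifP; lia.
transitivity (\sum_(j < n | step d i j && is_partition (incr_nth mu j)) F j).
  apply: eq_bigr => j /andP[_ muP']; apply: IH => //.
  by rewrite size_incr_nth; case: ifP => // _; apply: ltn_ord.
by rewrite (big_ord_widen_cond M (fun j => step d i j && is_partition (incr_nth mu j)) F).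
Qed.

End ChainRange.

Definition fat_hook u v t s := [:: u, v & nseq t 2 ++ nseq s 1]%N.

Section FatHooks.
Local Open Scope nat_scope.

Lemma nth_fat_hook u v t s j : nth 0 (fat_hook u v t s) j =
  if j == 0 then u else if j == 1 then v else
  if j < t + 2 then 2 else if j < t + s + 2 then 1 else 0.
Proof.
case: j => [|[|j]] //=; rewrite nth_cat size_nseq !nth_nseq.
have -> : (j.+2 < t + 2) = (j < t) by lia.
have -> : (j.+2 < t + s + 2) = (j < t + s) by lia.
case: ltnP => // h; have -> // : (j - t < s) = (j < t + s) by lia.
Qed.

Lemma size_fat_hook u v t s : size (fat_hook u v t s) = t + s + 2.
Proof. by rewrite /= size_cat !size_nseq; lia. Qed.

Lemma fat_hook_partition u v t s : v <= u -> 0 < v -> (0 < t -> 1 < v) ->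
  is_partition (fat_hook u v t s).
Proof.
move=> h1 h2 h3; apply/is_partitionP; split=> i.
  rewrite !nth_fat_hook; case: i => [|[|i]] //=; do !case: ifP; lia.
by rewrite size_fat_hook nth_fat_hook; do !case: ifP; lia.
Qed.

Lemma fat_hook_incr0 u v t s : incr_nth (fat_hook u v t s) 0 = fat_hook u.+1 v t s.
Proof. by []. Qed.

Lemma fat_hook_incr1 u v t s : incr_nth (fat_hook u v t s) 1 = fat_hook u v.+1 t s.
Proof. by []. Qed.

Lemma fat_hook_incr2 u v t s :
  incr_nth (fat_hook u v t s.+1) t.+2 = fat_hook u v t.+1 s.
Proof.
rewrite /fat_hook /=; congr [:: _, _ & _].
by elim: t => //= t ->.
Qed.

Lemma incr_nth_nseq1 s : incr_nth (nseq s 1) s = nseq s.+1 1.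
Proof. by elim: s => //= s ->. Qed.

Lemma fat_hook_incr_end u v t s :
  incr_nth (fat_hook u v t s) (t + s).+2 = fat_hook u v t s.+1.
Proof.
rewrite /fat_hook /=; congr [:: _, _ & _].
by elim: t => [|t IH] /=; [apply: incr_nth_nseq1 | rewrite IH].
Qed.

End FatHooks.

Section ChainEvaluation.
Variables (R : comNzRingType) (M : nat) (k : seq nat -> R).
Local Notation ch := (chains M).
Local Notation down := (Some true).
Local Notation left := (Some false).

Lemma chains_step1 d pat mu i j0 : (j0 < M)%N ->
    (forall j, step d i j && is_partition (incr_nth mu j) = (j == j0)) ->
  ch (d :: pat) k mu i = ch pat k (incr_nth mu j0) j0.
Proof.
by move=> lt h; rewrite /= (big_pred1 (Ordinal lt)) // => j; rewrite /= h.
Qed.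

Lemma chains_step2 d pat mu i j0 j1 : (j0 < j1 < M)%N ->
    (forall j, step d i j && is_partition (incr_nth mu j) = (j == j0) || (j == j1)) ->
  ch (d :: pat) k mu i = ch pat k (incr_nth mu j0) j0 + ch pat k (incr_nth mu j1) j1.
Proof.
move=> /andP[lt01 lt1] h; have lt0 := ltn_trans lt01 lt1.
rewrite /= (bigD1 (Ordinal lt0)) /=; last by rewrite h eqxx.
congr (_ + _); rewrite (big_pred1 (Ordinal lt1)) // => j.
by rewrite /= h -!val_eqE /=; lia.
Qed.

Lemma chains_row c pat u : (0 < M)%N -> (0 < u)%N ->
  ch (nseq c left ++ pat) k [:: u] 0 = ch pat k [:: (u + c)%N] 0.
Proof.
move=> M0; elim: c u => [|c IH] u u0; first by rewrite addn0.
rewrite [LHS](@chains_step1 _ _ _ _ 0) //; first by rewrite IH // addSnnS.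
have uP : is_partition [:: u] by rewrite /is_partition inE eq_sym -lt0n.
by move=> j; rewrite is_partition_incr //=; case: j.
Qed.

Lemma chains_column c pat u s : (s + c < M)%N -> (0 < u)%N ->
  ch (nseq c down ++ pat) k (u :: nseq s 1%N) s = ch pat k (u :: nseq (s + c) 1%N) (s + c).
Proof.
elim: c s => [|c IH] s ltM u0; first by rewrite addn0.
have uP : is_partition (u :: nseq s 1%N).
  apply/is_partitionP; split=> [[|i]|[|i]] /=; rewrite ?size_nseq ?nth_nseq //.
  - by case: ifP; lia.
  - by do !case: ifP; lia.
  - by rewrite ltnS => ->.
rewrite [LHS](@chains_step1 _ _ _ _ s.+1); first 1 last.
- by lia.
- case=> [|j]; first by [].
  rewrite is_partition_incr //= nth_nseq; case: j => [|j] /=; last rewrite nth_nseq.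
    by case: ifP; lia.
  by do !case: ifP; lia.
rewrite addnS -addSn -IH; last by []; last by lia.
by rewrite [incr_nth _ _]/= incr_nth_nseq1.
Qed.

Lemma chains_top_row b pat u v s : (0 < M)%N -> (v <= u)%N -> (0 < v)%N ->
  ch (nseq b left ++ pat) k (fat_hook u v 0 s) 0 = ch pat k (fat_hook (u + b) v 0 s) 0.
Proof.
move=> M0; elim: b u => [|b IH] u vu v0; first by rewrite addn0.
rewrite [LHS](@chains_step1 _ _ _ _ 0) //; first by rewrite fat_hook_incr0 IH ?addSnnS ?leqW.
by move=> j; rewrite is_partition_incr ?fat_hook_partition //; case: j.
Qed.

Lemma chains_two_rows b pat u v s : (1 < M)%N -> (v <= u)%N -> (0 < v)%N ->
  ch (nseq b left ++ pat) k (fat_hook u v 0 s) 1 =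
  \sum_(j < b.+1 | (v + j <= u)%N)
    ch pat k (fat_hook (u + (b - j)) (v + j) 0 s) (j == b :> nat).
Proof.
move=> M1; elim: b v => [|b IH] v vu v0.
  by rewrite (big_pred1 ord0) /= ?addn0 // => j; rewrite [j]ord1 addn0 vu.
rewrite [RHS]big_mkcond big_ord_recl -big_mkcond [in RHS]/= addn0 vu subn0.
have partE j : step left 1 j && is_partition (incr_nth (fat_hook u v 0 s) j) =
    (j == 0%N) || (j == 1%N) && (v < u)%N.
  by rewrite is_partition_incr ?fat_hook_partition //; case: j => [|[|j]].
case: (ltnP v u) => h.
  rewrite [LHS](@chains_step2 _ _ _ _ 0 1) ?M1 //; last first.
    by move=> j; rewrite partE h andbT.
  rewrite fat_hook_incr0 fat_hook_incr1 chains_top_row ?addSnnS ?(ltnW M1) ?leqW //.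
  congr (_ + _); rewrite IH //; apply: eq_big => j; first by rewrite addSnnS.
  by move=> _; rewrite /bump /= add1n subSS addSnnS.
rewrite [LHS](@chains_step1 _ _ _ _ 0) ?(ltnW M1) //; last first.
  by move=> j; rewrite partE ltnNge h andbF orbF.
rewrite big1 ?addr0; last by move=> j; rewrite /bump /=; lia.
by rewrite fat_hook_incr0 chains_top_row ?addSnnS ?(ltnW M1) ?leqW.
Qed.

Lemma chains_bottom c u v t s : (v <= u)%N -> (0 < v)%N -> ((0 < t)%N -> (1 < v)%N) ->
    (t + s + c + 1 < M)%N ->
  ch (nseq c down) k (fat_hook u v t s) (t + s).+1 = k (fat_hook u v t (s + c)).
Proof.
move=> vu v0 tv; elim: c s => [|c IH] s ltM; first by rewrite addn0.
rewrite [LHS](@chains_step1 _ _ _ _ (t + s).+2); first 1 last.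
- by lia.
- move=> j; rewrite is_partition_incr ?fat_hook_partition // !nth_fat_hook /=.
  by case: j => [|[|[|j]]] //=; do !case: ifP; lia.
by rewrite fat_hook_incr_end -addnS IH ?addSnnS //; lia.
Qed.

(** A down step extends the second column or opens a new row at the bottom, and after the latter
    only new rows are possible. So the [r] boxes of the second column come first and use up parts 1
    that are already there, whence [r <= s]. *)
Lemma chains_second_column c u v t s : (v <= u)%N -> (1 < v)%N ->
    (t + s + c + 1 < M)%N ->
  ch (nseq c down) k (fat_hook u v t s) t.+1 =
  \sum_(r < c.+1 | (r <= s)%N) k (fat_hook u v (t + r) (s - r + (c - r))).
Proof.
move=> vu v1; elim: c t s => [|c IH] t s ltM.
  by rewrite (big_pred1 ord0) /= ?addn0 ?subn0 ?addn0 // => j; rewrite [j]ord1.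
rewrite [RHS]big_mkcond big_ord_recl -big_mkcond [in RHS]/= addn0 !subn0 addrC.
have muP : is_partition (fat_hook u v t s) by rewrite fat_hook_partition //; lia.
case: s ltM muP => [|s] ltM muP.
  rewrite big1 ?add0r; last by move=> j; rewrite /bump /=; lia.
  rewrite [LHS](@chains_step1 _ _ _ _ (t + 0).+2); first 1 last.
  - by lia.
  - move=> j; rewrite is_partition_incr // !nth_fat_hook /=.
    by case: j => [|[|[|j]]] //=; do !case: ifP; lia.
  by rewrite fat_hook_incr_end -addnS chains_bottom //; lia.
rewrite [LHS](@chains_step2 _ _ _ _ t.+2 (t + s.+1).+2); first 1 last.
- by lia.
- move=> j; rewrite is_partition_incr // !nth_fat_hook /=.
  by case: j => [|[|[|j]]] //=; do !case: ifP; lia.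
rewrite fat_hook_incr2 fat_hook_incr_end -[(t + s.+1).+2]/((t + s.+1).+1.+1) -addnS.
rewrite chains_bottom ?addSnnS //; try lia.
congr (_ + _); rewrite IH //; last by lia.
apply: eq_big => j; first by rewrite /bump /=; lia.
by move=> _; rewrite /bump /= add1n !subSS addSnnS.
Qed.

(** With second part 1 no lower part can grow to 2, so every box opens a new row. *)
Lemma chains_hook c u s : (0 < u)%N -> (s + c + 1 < M)%N ->
  ch (nseq c down) k (fat_hook u 1 0 s) 1 = k (fat_hook u 1 0 (s + c)).
Proof.
case: c => [|c] u0 ltM; first by rewrite addn0.
rewrite [LHS](@chains_step1 _ _ _ _ s.+2); first 1 last.
- by lia.
- move=> j; rewrite is_partition_incr ?fat_hook_partition // !nth_fat_hook /=.
  by case: j => [|[|[|j]]] //=; do !case: ifP; lia.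
have /= -> := fat_hook_incr_end u 1 0 s.
by rewrite -addSnnS (@chains_bottom c u 1 0 s.+1) //; lia.
Qed.

(** Starting from row 0 instead of row 1 only adds the chains whose first box is in row 1. They are
    the origin of the second family, with second part [2 + j]. *)
Lemma chains_from_top c u v s : (v < u)%N -> (0 < v)%N -> (1 < M)%N ->
  ch (nseq c down) k (fat_hook u v 0 s) 0 =
  ch (nseq c down) k (fat_hook u v 0 s) 1 +
  (if c is c'.+1 then ch (nseq c' down) k (fat_hook u v.+1 0 s) 1 else 0).
Proof.
move=> vu v0 M1; case: c => [|c]; first by rewrite addr0.
rewrite [LHS]/= (bigD1 (Ordinal M1)) /=; last first.
  by apply: (@fat_hook_partition u v.+1 0 s).
rewrite addrC; congr (_ + _); apply: eq_bigl => j.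
rewrite -val_eqE /= andbAC; congr (_ && _).
by case: (j : nat) => [|[|]].
Qed.

End ChainEvaluation.

(** * Schur coefficients *)

Section SchurCoefficients.
Variable n : nat.

Definition alt_mon (mu : seq nat) : 'X_{1..n} :=
  [multinom (nth 0 mu i + (n - i.+1))%N | i < n].

Lemma leq_increasing (f : 'I_n -> 'I_n) :
  (forall i j : 'I_n, (i < j)%N -> (f i < f j)%N) -> forall i : 'I_n, (i <= f i)%N.
Proof.
move=> inc [m]; elim: m => // m IH lt; have lt' := ltnW lt.
exact: leq_ltn_trans (IH lt') (inc (Ordinal lt') (Ordinal lt) (ltnSn m)).
Qed.

Lemma increasing_perm (s : {perm 'I_n}) :
  (forall i j : 'I_n, (i < j)%N -> (s i < s j)%N) -> s = 1%g.
Proof.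
move=> inc; have inc' (i j : 'I_n) : (i < j)%N -> ((s^-1)%g i < (s^-1)%g j)%N.
  move=> lt; rewrite ltnNge leq_eqVlt; apply/negP => /orP[/eqP/val_inj/perm_inj e|/inc].
    by rewrite e ltnn in lt.
  by rewrite !permKV => /(ltn_trans lt); rewrite ltnn.
apply/permP => i; rewrite perm1; apply: val_inj; apply/eqP.
by rewrite eqn_leq (leq_increasing inc) -{2}[i](permK s) (leq_increasing inc').
Qed.

Lemma eq_partition la mu : is_partition la -> is_partition mu ->
  (forall i, nth 0%N la i = nth 0%N mu i) -> la = mu.
Proof.
move=> /is_partitionP[_ h1] /is_partitionP[_ h2] e.
apply: (@eq_from_nth _ 0%N) => //; apply/eqP; rewrite eqn_leq.
apply/andP; split; rewrite leqNgt; apply/negP => lt.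
  by have := h1 _ lt; rewrite e nth_default.
by have := h2 _ lt; rewrite -e nth_default.
Qed.

Lemma alt_expand (la : seq nat) : altp (xvar n) n la =
  \sum_(s : {perm 'I_n}) (-1) ^+ s *
    'X_[[multinom (nth 0 la ((s^-1)%g i) + (n - ((s^-1)%g i).+1))%N | i < n]].
Proof.
rewrite /altp /alt /determinant; apply: eq_bigr => s _; congr (_ * _).
rewrite (mpolyXE _ s); apply: eq_bigr => j _.
by rewrite mxE xvarE mnmE permK.
Qed.

(** Both exponent sequences decrease strictly, so a permutation matching them is increasing, hence
    the identity. *)
Lemma mcoeff_altp la mu : is_partition la -> is_partition mu ->
    (size la <= n)%N -> (size mu <= n)%N ->
  (altp (xvar n) n la)@_(alt_mon mu) = (la == mu)%:R.
Proof.
move=> laP muP lela lemu; rewrite alt_expand raddf_sum (bigD1 (1%g : {perm 'I_n})) //= big1 ?addr0.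
  rewrite odd_perm1 expr0 mul1r mcoeffX; congr (nat_of_bool _)%:R.
  apply/eqP/eqP => [/mnmP e|->]; last by apply/mnmP => i; rewrite !mnmE invg1 perm1.
  apply: eq_partition => // i; case: (ltnP i n) => lti; last first.
    by rewrite !nth_default //; [apply: leq_trans lti | apply: leq_trans lti].
  by have := e (Ordinal lti); rewrite !mnmE invg1 perm1 => /addIn.
move=> s; apply: contraNeq => nz; apply/eqP.
have e : [multinom (nth 0 la ((s^-1)%g i) + (n - ((s^-1)%g i).+1))%N | i < n] = alt_mon mu.
  apply/eqP; apply: contraNT nz => /negPf ne.
  by case: (odd_perm s); rewrite ?expr0 ?expr1 ?mul1r ?mulN1r ?mcoeffN mcoeffX ne ?oppr0.
rewrite -[s]invgK (_ : s^-1 = 1)%g ?invg1 //; apply: increasing_perm => i j lt.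
have /is_partitionP[decl _] := laP; have /is_partitionP[decm _] := muP.
have /mnmP ei := e; have := ei i; have := ei j; rewrite !mnmE => ej' ei'.
have hm := decr_le decm (ltnW lt); rewrite ltnNge; apply/negP => hs.
have := decr_le decl hs.
by have := ltn_ord ((s^-1)%g i); have := ltn_ord ((s^-1)%g j); have := ltn_ord j; lia.
Qed.

Lemma altp0_neq0 : altp (xvar n) n [::] != 0.
Proof.
apply/eqP => e; have := @mcoeff_altp [::] [::] isT isT isT isT.
by rewrite e mcoeff0 eqxx => /eqP; rewrite eq_sym oner_eq0.
Qed.

Lemma mcoeff_schur la mu : is_partition la -> is_partition mu -> (size mu <= n)%N ->
  (altp (xvar n) n [::] * schur la n)@_(alt_mon mu) = (la == mu)%:R.
Proof.
move=> laP muP lemu; case: (leqP (size la) n) => h.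
  by rewrite schur_bialternant // mcoeff_altp.
by rewrite schur_eq0 // mulr0 mcoeff0; case: eqP h => // ->; rewrite ltnNge lemu.
Qed.

End SchurCoefficients.

(** Linear independence of Schur functions, made effective: [size mu] variables are enough to read
    off the coefficient of [mu]. *)
Lemma mcoeff_schur_sum (s : seq (seq nat)) (c : seq nat -> int) mu :
    uniq s -> all is_partition s -> is_partition mu ->
  (altp (xvar (size mu)) (size mu) [::] *
    \sum_(la <- s) c la *: schur la (size mu))@_(alt_mon (size mu) mu) =
  if mu \in s then c mu else 0.
Proof.
move=> us /allP ps muP; rewrite big_distrr raddf_sum /=.
rewrite (eq_big_seq (fun la => if la == mu then c mu else 0)) => [|la las].
  rewrite -big_mkcond; case: ifP => mus.
    by rewrite -big_filter filter_pred1_uniq // big_seq1.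
  rewrite big_seq_cond big1 // => la /andP[las /eqP e].
  by rewrite -e las in mus.
rewrite -scalerAr mcoeffZ (mcoeff_schur (ps _ las) muP) //.
by case: eqP => [->|_]; rewrite ?mulr1 ?mulr0.
Qed.

(** A shape of [s1] missing from [s2] would have coefficient -1 in the difference. *)
Lemma schur_nonneg_sub (F1 F2 : symfun) (s1 s2 : seq (seq nat)) :
    uniq s1 -> uniq s2 -> all is_partition s1 -> all is_partition s2 ->
    (forall n, F1 n = \sum_(la <- s1) schur la n) ->
    (forall n, F2 n = \sum_(la <- s2) schur la n) ->
  schur_nonneg (symfun_sub F2 F1) <-> {subset s1 <= s2}.
Proof.
move=> u1 u2 p1 p2 e1 e2; split=> [[s [c [[us ps e] c0]]] mu mu1|sub].
  have muP : is_partition mu by apply: (allP p1).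
  have ex s' n : \sum_(la <- s') schur la n = \sum_(la <- s') (1 : int) *: schur la n.
    by apply: eq_bigr => la _; rewrite scale1r.
  have := congr1 (fun F => (altp (xvar (size mu)) (size mu) [::] * F)@_(alt_mon (size mu) mu))
    (e (size mu)).
  rewrite /symfun_sub mulrBr mcoeffB e1 e2 !ex !mcoeff_schur_sum // mu1.
  case: (mu \in s2) => //; case: ifP => [/c0|_] //; lia.
exists [seq la <- s2 | la \notin s1], (fun=> 1); split=> //; split.
- exact: filter_uniq.
- by apply/allP => la; rewrite mem_filter => /andP[_ /(allP p2)].
move=> n; rewrite /symfun_sub e1 e2 big_filter (bigID (fun la => la \in s1)) /=.
rewrite -big_filter (perm_big s1) /=.
  by rewrite addrAC subrr add0r; apply: eq_bigr => la _; rewrite scale1r.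
apply: uniq_perm => //; first exact: filter_uniq.
by move=> la; rewrite mem_filter andb_idr // => /sub.
Qed.

(** * Schur expansion of ribbons with at most two rows longer than 1 *)

Lemma ribbon_pattern_ones q m :
  ribbon_pattern (q :: nseq m 1%N) = nseq q.-1 false ++ nseq m true.
Proof.
elim: m q => // m IH q.
by rewrite -[LHS]/(_ ++ true :: ribbon_pattern (1%N :: nseq m 1%N)) IH.
Qed.

Lemma ribbon_pattern_two_rows p s q m :
  ribbon_pattern (p :: nseq s 1%N ++ q :: nseq m 1%N) =
  nseq p.-1 false ++ nseq s.+1 true ++ nseq q.-1 false ++ nseq m true.
Proof.
elim: s p => [|s IH] p.
  by rewrite -[LHS]/(_ ++ true :: ribbon_pattern (q :: nseq m 1%N)) ribbon_pattern_ones.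
by rewrite -[LHS]/(_ ++ true :: ribbon_pattern (1%N :: nseq s 1%N ++ q :: nseq m 1%N)) IH.
Qed.

Lemma big_ord_min (V : nmodType) A B (F : nat -> V) :
  \sum_(j < A | (j < B)%N) F j = \sum_(j < minn A B) F j.
Proof.
rewrite (big_ord_widen A) ?geq_minl //; apply: eq_bigl => j.
by rewrite leq_min ltn_ord.
Qed.

Lemma big_iota0 (V : nmodType) A (F : nat -> V) :
  \sum_(j <- iota 0 A) F j = \sum_(j < A) F j.
Proof. by rewrite -(big_mkord xpredT) /index_iota subn0. Qed.

Section TwoRowRibbons.
Variables p b s m : nat.
Hypothesis p_gt0 : (0 < p)%N.
Hypothesis b_gt0 : (0 < b)%N.
Local Notation left := (Some false).
Local Notation down := (Some true).

Lemma chains_two_row_ribbon (R : comNzRingType) M (k : seq nat -> R) :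
    (s + m + 2 < M)%N ->
  chains M (None :: map Some (ribbon_pattern (p :: nseq s 1%N ++ b.+1 :: nseq m 1%N))) k [::] 0 =
  \sum_(j < b.+1 | (1 + j <= p)%N)
     chains M (nseq m down) k (fat_hook (p + (b - j)) (1 + j) 0 s) 1 +
  (if m is m'.+1 then \sum_(j < b | (1 + j <= p)%N)
     chains M (nseq m' down) k (fat_hook (p + (b - j)) (2 + j) 0 s) 1 else 0).
Proof.
move=> ltM; rewrite ribbon_pattern_two_rows !map_cat !map_nseq [b.+1.-1]/=.
rewrite (@chains_step1 _ _ _ _ _ _ _ 0); first 1 last.
- by lia.
- by move=> j; rewrite is_partition_incr // !nth_nil orbF.
rewrite [incr_nth _ _]/= chains_row; try lia.
rewrite add1n prednK // (@chains_column _ _ _ s.+1 _ p 0) ?add0n //; last by lia.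
rewrite -[p :: _]/(fat_hook p 1 0 s).
(* In this hook no row from 2 to [s.+1] can take a box, so a left step from row [s.+1] has the same
   choices as one from row 1. *)
transitivity (chains M (nseq b left ++ nseq m down) k (fat_hook p 1 0 s) 1).
  case: b b_gt0 => // b' _ /=; apply: eq_bigl => j.
  rewrite is_partition_incr ?(@fat_hook_partition p 1 0 s) // !nth_fat_hook.
  case: (j : nat) => [|[|[|j']]] //=; do !case: ifP; lia.
rewrite chains_two_rows //; last by lia.
(* The term [j = b] stands in row 1; the others stand in row 0 and are split by
   [chains_from_top]. *)
rewrite big_mkcond big_ord_recr -big_mkcond /= eqxx.
rewrite [in RHS]big_mkcond big_ord_recr -big_mkcond /= addrAC; congr (_ + _).
case: m ltM => [|m'] ltM; first by rewrite addr0.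
rewrite -big_split; apply: eq_bigr => j hj; have := ltn_ord j => ltj.
by rewrite (ltn_eqF ltj) (@chains_from_top _ _ _ m'.+1) //; lia.
Qed.

(* Indices (e, j, r) of the shapes (p + b - j, 1 + e + j, 2^r, 1^(s + m - e - 2 r)). *)
Definition two_row_index : seq (nat * nat * nat) :=
  ((0, 0, 0) ::
   [seq (0, j.+1, r) | j <- iota 0 (minn b p.-1), r <- iota 0 (minn s m).+1] ++
   [seq (1, j, r) | j <- iota 0 (minn b p), r <- iota 0 (minn s.+1 m)])%N.

Definition two_row_shape D L (i : nat * nat * nat) : seq nat :=
  (fat_hook (D - i.1.2) (1 + i.1.1 + i.1.2) i.2 (L - i.1.1 - i.2.*2))%N.

Lemma chains_two_row_index (R : comNzRingType) M (k : seq nat -> R) :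
    (s + m + 2 < M)%N ->
  chains M (None :: map Some (ribbon_pattern (p :: nseq s 1%N ++ b.+1 :: nseq m 1%N))) k [::] 0 =
  \sum_(i <- two_row_index) k (two_row_shape (p + b) (s + m) i).
Proof.
move=> ltM; rewrite chains_two_row_ribbon // /two_row_index big_cons big_cat !big_allpairs_dep.
rewrite addrA [in LHS]big_mkcond big_ord_recl -big_mkcond [in LHS]/= addn0 p_gt0.
(* The term [j = 0] has second part 1 and gives a single hook, hence the separate index (0, 0,
   0). *)
rewrite chains_hook; first 1 last; try lia.
rewrite subn0 !big_iota0; congr (_ + _ + _).
- by rewrite /two_row_shape /= subn0 !subn0.
- pose F j := \sum_(r <- iota 0 (minn s m).+1) k (two_row_shape (p + b) (s + m) (0, j.+1, r)%N).
  rewrite -(big_ord_min b p.-1 F); apply: eq_big => j; first by rewrite /bump /=; lia.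
  rewrite /F /bump [in LHS]/= => hj; rewrite (@chains_second_column _ _ _ _ _ _ 0 s); try lia.
  pose G r := k (two_row_shape (p + b) (s + m) (0, j.+1, r)%N).
  rewrite big_iota0 -minnSS minnC -(big_ord_min m.+1 s.+1 G); apply: eq_bigr => r hr.
  by congr (k (fat_hook _ _ _ _)); rewrite /=; have := ltn_ord j; have := ltn_ord r; lia.
case: m ltM => [|m'] ltM.
  by rewrite big1 // => j _; rewrite minn0 big_nil.
pose F j := \sum_(r <- iota 0 (minn s.+1 m'.+1)) k (two_row_shape (p + b) (s + m'.+1) (1, j, r)%N).
rewrite -(big_ord_min b p F); apply: eq_big => // j hj.
rewrite /F (@chains_second_column _ _ _ _ _ _ 0 s); try (have := ltn_ord j; lia).
pose G r := k (two_row_shape (p + b) (s + m'.+1) (1, j : nat, r)%N).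
rewrite big_iota0 minnC -(big_ord_min m'.+1 s.+1 G); apply: eq_bigr => r hr.
by congr (k (fat_hook _ _ _ _)); rewrite /=; have := ltn_ord j; have := ltn_ord r; lia.
Qed.

End TwoRowRibbons.

(** * The order *)

Section IndexSets.
Local Open Scope nat_scope.

Lemma mem_two_row_index p b s m e j r : (e, j, r) \in two_row_index p b s m =
  [|| [&& e == 0, j == 0 & r == 0],
      [&& e == 0, 0 < j <= minn b p.-1 & r <= minn s m] |
      [&& e == 1, j < minn b p & r < minn s.+1 m]].
Proof.
rewrite /two_row_index in_cons mem_cat !xpair_eqE; congr [|| _, _ | _]; first by rewrite andbA.
  apply/allpairsPdep/and3P => [[j' [r' [+ + [-> -> ->]]]]|[/eqP -> hj hr]].
    by rewrite !mem_iota => h1 h2; split; lia.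
  by exists j.-1, r; rewrite !mem_iota; split; [lia | lia | congr (_, _, _); lia].
apply/allpairsPdep/and3P => [[j' [r' [+ + [-> -> ->]]]]|[/eqP -> hj hr]].
  by rewrite !mem_iota => h1 h2; split; lia.
by exists j, r; rewrite !mem_iota; split.
Qed.

Lemma uniq_two_row_index p b s m : uniq (two_row_index p b s m).
Proof.
rewrite /two_row_index cons_uniq cat_uniq mem_cat negb_or -andbA.
apply/and5P; split.
- by apply/allpairsPdep => -[j [r [_ _ []]]].
- by apply/allpairsPdep => -[j [r [_ _ []]]].
- apply: allpairs_uniq; rewrite ?iota_uniq // => -[j r] [j' r'] _ _ [-> ->] //.
- by apply/hasPn => x /allpairsPdep[j [r [_ _ ->]]]; apply/allpairsPdep => -[j' [r' [_ _ []]]].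
- apply: allpairs_uniq; rewrite ?iota_uniq // => -[j r] [j' r'] _ _ [-> ->] //.
Qed.

Definition valid_index D L (i : nat * nat * nat) :=
  (i.1.2 <= D) && (i.1.1 + i.2.*2 <= L).

(** The first part determines [j], the second part then [e], and the number of rows then [r];
    validity keeps the subtractions from being truncated. *)
Lemma two_row_shape_inj D L : {in valid_index D L &, injective (two_row_shape D L)}.
Proof.
move=> [[e j] r] [[e' j'] r'] /andP[/= h1 h2] /andP[/= h1' h2'] eqs.
have e0 := congr1 (nth 0 ^~ 0) eqs; have e1 := congr1 (nth 0 ^~ 1) eqs.
have e2 := congr1 size eqs; move: e0 e1 e2; rewrite !size_fat_hook /= => e0 e1 e2.
by congr (_, _, _); lia.
Qed.

Lemma two_row_index_valid p b s m i : i \in two_row_index p b s m ->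
  valid_index (p + b) (s + m) i.
Proof.
case: i => [[e j] r]; rewrite mem_two_row_index /valid_index /=.
by case/or3P => /and3P[/eqP -> h1 h2]; apply/andP; split; lia.
Qed.

Lemma two_row_shape_partition p b s m i : 0 < p -> i \in two_row_index p b s m ->
  is_partition (two_row_shape (p + b) (s + m) i).
Proof.
case: i => [[e j] r] p0; rewrite mem_two_row_index /two_row_shape /=.
by case/or3P => /and3P[/eqP -> h1 h2]; apply: fat_hook_partition; lia.
Qed.

Lemma subset_two_row_shapes p1 b1 s1 m1 p2 b2 s2 m2 D L :
    p1 + b1 = D -> p2 + b2 = D -> s1 + m1 = L -> s2 + m2 = L ->
  {subset map (two_row_shape D L) (two_row_index p1 b1 s1 m1) <=
     map (two_row_shape D L) (two_row_index p2 b2 s2 m2)} <->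
  {subset two_row_index p1 b1 s1 m1 <= two_row_index p2 b2 s2 m2}.
Proof.
move=> D1 D2 L1 L2; split=> sub x; last first.
  by case/mapP=> i /sub i2 ->; apply: map_f.
move=> x1; have /mapP[y y2 e] := sub _ (map_f (two_row_shape D L) x1).
have vx : valid_index D L x by rewrite -D1 -L1 two_row_index_valid.
have vy : valid_index D L y by rewrite -D2 -L2 two_row_index_valid.
by rewrite (two_row_shape_inj vx vy e).
Qed.

End IndexSets.

Lemma two_row_ribbon_expansion p b s m n : (0 < p)%N -> (0 < b)%N ->
  ribbon_schur (p :: nseq s 1%N ++ b.+1 :: nseq m 1%N) n =
  \sum_(la <- map (two_row_shape (p + b) (s + m)) (two_row_index p b s m)) schur la n.
Proof.
move=> p0 b0; apply: (mulfI (altp0_neq0 n)).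
rewrite ribbon_words // chains_words //.
(* At least [n], as widening requires, and larger than [s + m + 2], so that no chain runs out of
   rows. *)
pose M := (n + (s + m + 3))%N.
rewrite (@chains_widen _ n M _ (fun la => altp (xvar n) n [::] * schur la n)) //.
- rewrite chains_two_row_index //; last by rewrite /M; lia.
  by rewrite big_map big_distrr.
- exact: leq_addr.
- by move=> nu nuP le; rewrite schur_bialternant.
- by move=> nu nuP lt; rewrite schur_eq0 ?mulr0.
Qed.

(** * The two total orders and inclusion of the index sets *)

Section Ranks.
Local Open Scope nat_scope.

(** For [s = a - 1] and [m = l - a - 1] the two bounds are [(minn s m).+1] and [minn s.+1 m], the
    limits for [r] in the two families. With N - l + 1 and [b] in place of [l] and [a] they are the
    limits for [j]. *)
Definition lo_bound l a := minn a (l - a).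
Definition hi_bound l a := minn a (l - a - 1).

(* Along l - 1 < 1 < l - 2 < 2 < ... exactly one of the two bounds increases,
   by 1, at each step. *)
Definition rank l a := lo_bound l a + hi_bound l a.

Lemma rank_bounds l a : 0 < a < l ->
  0 < lo_bound l a /\ hi_bound l a <= lo_bound l a <= (hi_bound l a).+1.
Proof. by rewrite /lo_bound /hi_bound; lia. Qed.

(** The bounds differ by at most 1, with [lo_bound] never the smaller, so each is a monotone
    function of their sum. *)
Lemma leq_rank l a a' : 0 < a < l -> 0 < a' < l ->
  (rank l a <= rank l a') =
  (lo_bound l a <= lo_bound l a') && (hi_bound l a <= hi_bound l a').
Proof. by move=> /rank_bounds[_ +] /rank_bounds[_ +]; rewrite /rank; lia. Qed.

Lemma rank_inj l a a' : 0 < a < l -> 0 < a' < l -> rank l a = rank l a' -> a = a'.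
Proof. by rewrite /rank /lo_bound /hi_bound; lia. Qed.

End Ranks.

Section RealOrders.
Variables (R : realFieldType) (eps : R).
Hypotheses (eps_gt0 : 0 < eps) (eps_lt_half : eps < 1 / 2).


(** A number c lies to the left of the centre iff 2c < l. On one side the numbers themselves are
    compared; across the centre a + a' is compared with l - 2 eps, and 0 < 2 eps < 1 turns this into
    a comparison of integers with l. *)
Lemma lt_hP l a a' : (a < l)%N -> (a' < l)%N ->
  lt_h eps l a a' <-> (rank l a < rank l a')%N.
Proof.
move=> al al'.
have dist (c : nat) : `|c%:R - (l%:R / 2 - eps)| =
    if (c.*2 < l)%N then l%:R / 2 - eps - c%:R else c%:R - l%:R / 2 + eps.
  case: ltnP => h.
    have : c.*2.+1%:R <= l%:R :> R by rewrite ler_nat.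
    rewrite -addn1 natrD -muln2 natrM => h1.
    by rewrite ler0_norm; [ring | move: h1 eps_gt0 eps_lt_half; lra].
  have : l%:R <= c.*2%:R :> R by rewrite ler_nat.
  rewrite -muln2 natrM => h1.
  by rewrite ger0_norm; [ring | move: h1 eps_gt0; lra].
rewrite /lt_h !dist.
have natlt (c d : nat) : (c < d)%N -> c%:R + 1 <= d%:R :> R.
  by rewrite natr1 ler_nat.
have natle (c d : nat) : (c <= d)%N -> c%:R <= d%:R :> R by rewrite ler_nat.
have -> : (rank l a < rank l a')%N = if (a.*2 < l)%N then
    if (a'.*2 < l)%N then (a < a')%N else (a + a' < l)%N
  else if (a'.*2 < l)%N then (l <= a + a')%N else (a' < a)%N.
  have rankE c : (c < l)%N ->
      rank l c = if (c.*2 < l)%N then c.*2 else (l - c).*2.-1.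
    by rewrite /rank /lo_bound /hi_bound; case: ifP; lia.
  by rewrite !rankE //; do !case: ifP; lia.
case: (ltnP a.*2 l) => _; case: (ltnP a'.*2 l) => _.
- case: (ltnP a a') => [/natlt|/natle] h; split=> // h'; lra.
- case: (ltnP (a + a') l) => [/natlt|/natle]; rewrite natrD => h;
  split=> // h'; move: h h' eps_gt0 eps_lt_half; lra.
- case: (leqP l (a + a')) => [/natle|/natlt]; rewrite natrD => h;
  split=> // h'; move: h h' eps_gt0 eps_lt_half; lra.
- case: (ltnP a' a) => [/natlt|/natle] h; split=> // h'; lra.
Qed.

Lemma le_hP l a a' : (0 < a < l)%N -> (0 < a' < l)%N ->
  le_h eps l a a' <-> (rank l a <= rank l a')%N.
Proof.
move=> Ba Ba'; rewrite /le_h lt_hP; [|by case/andP: Ba..|by case/andP: Ba'].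
split=> [[->//|/ltnW//]|]; rewrite leq_eqVlt => /orP[/eqP e|]; last by right.
by left; apply: rank_inj e.
Qed.

End RealOrders.

Lemma mem_two_row_index_bounds D l a b e j r : (0 < a < l)%N -> (0 < b <= D)%N ->
  (e, j, r) \in two_row_index (D - b + 1) b (a - 1) (l - a - 1) =
  [|| [&& e == 0, j == 0 & r == 0],
      [&& e == 0, 0 < j <= hi_bound D.+1 b & r < lo_bound l a] |
      [&& e == 1, j < lo_bound D.+1 b & r < hi_bound l a]]%N.
Proof.
move=> Ba Bb; rewrite mem_two_row_index /lo_bound /hi_bound.
have -> : minn b (D - b + 1).-1 = minn b (D.+1 - b - 1) by lia.
have -> : minn b (D - b + 1) = minn b (D.+1 - b) by lia.
have -> : minn (a - 1).+1 (l - a - 1) = minn a (l - a - 1) by lia.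
by have -> : (r <= minn (a - 1) (l - a - 1))%N = (r < minn a (l - a))%N by lia.
Qed.

(** Each family is a rectangle of pairs (j, r). If it is not empty, its extreme corner shows that
    both of its bounds must grow. *)
Lemma subset_two_row_index D l a1 b1 a2 b2 :
    in_S (D + l) l a1 b1 -> (0 < a1 < l)%N -> (0 < b1 <= D)%N ->
    (0 < a2 < l)%N -> (0 < b2 <= D)%N ->
  {subset two_row_index (D - b1 + 1) b1 (a1 - 1) (l - a1 - 1) <=
     two_row_index (D - b2 + 1) b2 (a2 - 1) (l - a2 - 1)} <->
  (rank l a1 <= rank l a2)%N /\ (rank D.+1 b1 <= rank D.+1 b2)%N.
Proof.
rewrite /in_S addnK => S1 Ba1 Bb1 Ba2 Bb2; rewrite !leq_rank //.
split=> [sub|[/andP[la ha] /andP[lb hb]] [[e j] r]]; last first.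
  rewrite !mem_two_row_index_bounds // => /or3P[->//||] /and3P[-> h1 h2]; apply/or3P.
    apply: Or32; rewrite (leq_trans h2 la) andbT.
    by have /andP[-> h] := h1; apply: leq_trans h hb.
  by apply: Or33; rewrite (leq_trans h1 lb) (leq_trans h2 ha).
have H0 : (0 < hi_bound D.+1 b1 -> hi_bound D.+1 b1 <= hi_bound D.+1 b2 /\
    lo_bound l a1 <= lo_bound l a2)%N.
  have [lo_gt0 _] := rank_bounds Ba1; have [lo_gt0' _] := rank_bounds Ba2.
  move=> h; have := sub (0, hi_bound D.+1 b1, (lo_bound l a1).-1)%N.
  by rewrite !mem_two_row_index_bounds // prednK // h !leqnn /=
    !orbF orbT gtn_eqF //= => /(_ isT)/andP.
have H1 : (0 < hi_bound l a1 -> lo_bound D.+1 b1 <= lo_bound D.+1 b2 /\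
    hi_bound l a1 <= hi_bound l a2)%N.
  have [lo_gt0 _] := @rank_bounds D.+1 b1 Bb1.
  move=> h; have := sub (1, (lo_bound D.+1 b1).-1, (hi_bound l a1).-1)%N.
  by rewrite !mem_two_row_index_bounds // !prednK // !leqnn /= => /(_ isT)/andP.
(* Either both rectangles are non-empty, or one is empty and its bounds are minimal or equal to a
   bound of the other, or all four bounds are minimal. *)
have S1' : [\/ (0 < hi_bound l a1 /\ 0 < hi_bound D.+1 b1)%N,
    [/\ lo_bound l a1 = 1, hi_bound l a1 = 0 & lo_bound D.+1 b1 = hi_bound D.+1 b1],
    [/\ lo_bound D.+1 b1 = 1, hi_bound D.+1 b1 = 0 & lo_bound l a1 = hi_bound l a1] |
    [/\ lo_bound l a1 = 1, hi_bound l a1 = 0,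
        lo_bound D.+1 b1 = 1 & hi_bound D.+1 b1 = 0]]%N.
  clear sub H0 H1; move: Ba1 Bb1; rewrite /lo_bound /hi_bound.
  case: S1 => S1 Ba1 Bb1; [apply: Or41 | apply: Or42 | apply: Or43 | apply: Or44];
    by split; lia.
have := rank_bounds Ba1; have := rank_bounds Ba2.
have := @rank_bounds D.+1 b1 Bb1; have := @rank_bounds D.+1 b2 Bb2.
move: H0 H1 S1'; clear.
move: (lo_bound l a1) (lo_bound l a2) (hi_bound l a1) (hi_bound l a2) => p1 p2 q1 q2.
move: (lo_bound _ b1) (lo_bound _ b2) (hi_bound _ b1) (hi_bound _ b2) => u1 u2 v1 v2.
by move=> H0 H1 [[]|[]|[]|[]]; lia.
Qed.

Local Close Scope ring_scope.

Theorem theorem5p2 (R : realFieldType) (eps : R)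
    (eps_gt0 : (0 < eps)%R) (eps_lt_half : (eps < 1 / 2)%R)
    (N l : nat) (l_ge2 : 2 <= l) (N_gt : l + 1 <= N)
    (a1 b1 a2 b2 : nat)
    (S1 : in_S N l a1 b1) (S2 : in_S N l a2 b2) :
  le_s N l (class_ab N l a1 b1) (class_ab N l a2 b2) <->
  le_h eps l a1 a2 /\ le_w eps N l b1 b2.
Proof.
have [D eN] : exists D, N = (D + l) by exists (N - l); lia.
have bounds a b : in_S N l a b -> 0 < a < l /\ 0 < b <= D.
  by rewrite eN /in_S addnK; case; lia.
have [Ba1 Bb1] := bounds _ _ S1; have [Ba2 Bb2] := bounds _ _ S2.
pose al a b : seq nat :=
  (N - l - b + 1) :: nseq (a - 1) 1 ++ (b + 1) :: nseq (l - a - 1) 1.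
pose supp a b := map (two_row_shape D.+1 (l - 2))
  (two_row_index (D - b + 1) b (a - 1) (l - a - 1)).
have exp a b n : 0 < a < l -> 0 < b <= D ->
    ribbon_schur (al a b) n = (\sum_(la <- supp a b) schur la n)%R.
  move=> Ba Bb; rewrite /al [b + 1]addn1 two_row_ribbon_expansion; try lia.
  by rewrite /supp eN addnK; congr (\sum_(la <- map (two_row_shape _ _) _) _)%R; lia.
have supp_uniq a b : 0 < a < l -> 0 < b <= D -> uniq (supp a b).
  move=> Ba Bb; rewrite map_inj_in_uniq ?uniq_two_row_index // => x y.
  have eD : D - b + 1 + b = D.+1 by lia.
  have eL : a - 1 + (l - a - 1) = l - 2 by lia.
  move=> /two_row_index_valid hx /two_row_index_valid hy.
  by apply: two_row_shape_inj; rewrite unfold_in -eD -eL.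
have supp_part a b : 0 < a < l -> 0 < b <= D -> all is_partition (supp a b).
  move=> Ba Bb; apply/allP => la /mapP[i hi ->].
  have -> : D.+1 = D - b + 1 + b by lia.
  have -> : l - 2 = a - 1 + (l - a - 1) by lia.
  by apply: two_row_shape_partition hi; rewrite addn1.
have mf a b : 0 < a < l -> 0 < b <= D -> mf_ribbon N l (al a b).
  move=> Ba Bb; split.
  - rewrite /is_composition inE mem_cat inE !negb_or !mem_nseq; lia.
  - by rewrite /= sumn_cat /= !sumn_nseq; lia.
  - by rewrite /= size_cat /= !size_nseq; lia.
  exists (supp a b), (fun=> 1%R); split; last by right.
  split; [exact: supp_uniq | exact: supp_part |] => n.
  by rewrite exp //; apply: eq_bigr => la _; rewrite scale1r.
have class a b : 0 < a < l -> 0 < b <= D -> class_ab N l a b (al a b).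
  by move=> Ba Bb; split; first exact: mf.
have inM a b : 0 < a < l -> 0 < b <= D -> in_M N l (class_ab N l a b).
  by move=> Ba Bb; exists (al a b); first exact: mf.
have nonneg := schur_nonneg_sub (supp_uniq _ _ Ba1 Bb1) (supp_uniq _ _ Ba2 Bb2)
  (supp_part _ _ Ba1 Bb1) (supp_part _ _ Ba2 Bb2).
have sub : {subset supp a1 b1 <= supp a2 b2} <->
    le_h eps l a1 a2 /\ le_w eps N l b1 b2.
  rewrite (le_hP eps_gt0) // subset_two_row_shapes; try lia.
  rewrite subset_two_row_index -?eN //; try lia.
  (* The order on the [b] is the order on the [a] with N - l + 1 in place of [l]. *)
  rewrite -(le_hP eps_gt0 eps_lt_half (l := D.+1)) //.
  by rewrite /le_w /lt_w eN addnK addn1.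
rewrite -sub; split=> [[_ _ h]|h].
  apply/(nonneg (ribbon_schur (al a1 b1)) (ribbon_schur (al a2 b2))).
  - by move=> n; apply: exp.
  - by move=> n; apply: exp.
  - by apply: h; apply: class.
split; [exact: inM | exact: inM |] => al' be' [_ e1] [_ e2].
apply/nonneg => // n; [rewrite e1 | rewrite e2]; exact: exp.
Qed.
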